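(* Let $g=(g_1,\ldots,g_m)\in\mathcal V_r^m$, let $K=\{(x,\lambda)\in\mathbb R^n\times\mathbb R^r:g_i(x,\lambda)\ge0,\ i=1,\ldots,m\}$, and suppose that $\mathcal M_x(g)$ is restricted Archimedean. Let $y=(y_\alpha)_{\alpha\in\mathbb N^n}$ and $z^{(k)}=(z^{(k)}_\alpha)_{\alpha\in\mathbb N^n}$, $k=1,\ldots,r$, be real sequences that are represented by some Borel probability measure on $K$, and let $(\mu,\tau)$ be the graph data of $(y,z)$, uniquely determined up to $\mu$-null sets. Then a Borel probability measure $\rho$ on $K$ represents $(y,z)$ if and only if it has a disintegration $$\rho(dx,d\lambda)=\mu(dx)\,\pi_x(d\lambda)$$ with a measurable probability kernel $\pi_x$ such that, for $\mu$-almost every $x$, $$\operatorname{supp}\pi_x\subseteq\Lambda(x),\qquad \int_{\Lambda(x)}\lambda\,d\pi_x(\lambda)=\tau(x).$$ Thus all representing measures have the same $x$-marginal and the same conditional parameter barycenter.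
   Context: Here $x=(x_1,\ldots,x_n)$, $\lambda=(\lambda_1,\ldots,\lambda_r)$. $\mathcal V_r=\{p_0(x)+\sum_{k=1}^r\lambda_k p_k(x): p_0,\ldots,p_r\in\mathbb R[x]\}$. $\Sigma[x]$ is the cone of finite sums of squares in $\mathbb R[x]$. $\mathcal M_x(g)=\{\sigma_0+\sum_{i=1}^m\sigma_i g_i:\sigma_0,\ldots,\sigma_m\in\Sigma[x]\}$; it is restricted Archimedean if for every $p\in\mathcal V_r$ there is $N>0$ with $N+p,\ N-p\in\mathcal M_x(g)$. A Borel probability measure $\rho$ on $K$ represents $(y,z)$ if $y_\alpha=\int_Kx^\alpha\,d\rho$ and $z^{(k)}_\alpha=\int_Kx^\alpha\lambda_k\,d\rho$ for all $\alpha\in\mathbb N^n$ and $k=1,\ldots,r$. Graph data of $(y,z)$: a compactly supported Borel probability measure $\mu$ on $\mathbb R^n$ and a map $\tau=(\tau_1,\ldots,\tau_r)$ with $\tau_k\in L^\infty(\mu)$ such that $y_\alpha=\int x^\alpha\,d\mu$, $z^{(k)}_\alpha=\int x^\alpha\tau_k\,d\mu$ for all $\alpha,k$, and $(x,\tau(x))\in K$ for $\mu$-almost every $x$; when $(y,z)$ has a representing measure on $K$ and $\mathcal M_x(g)$ is restricted Archimedean, such data exist, $\mu$ is unique, and $\tau$ is unique $\mu$-a.e. For $x\in\mathbb R^n$, $\Lambda(x)=\{\lambda\in\mathbb R^r:g_i(x,\lambda)\ge0,\ i=1,\ldots,m\}$, a closed convex set. *)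

(* Defs.v *)
From HB Require Import structures.
From mathcomp Require Import all_boot all_order all_algebra.
(* The notations of [mpoly] clash with those of MathComp-Analysis. *)
From mathcomp Require mpoly.
Import -(notations) mpoly.
From mathcomp Require Import all_classical all_reals all_analysis.

Set Implicit Arguments.
Unset Strict Implicit.
Unset Printing Implicit Defensive.
Import Order.TTheory GRing.Theory Num.Theory.
Import numFieldNormedType.Exports.

Local Open Scope classical_set_scope.
Local Open Scope ring_scope.

(* The Borel sigma-algebra of a space of real matrices.  In particular 'rV[R]_n
   carries the Borel sigma-algebra of R^n, and since these spaces are second
   countable the product sigma-algebra that the library puts on
   'rV[R]_n * 'rV[R]_r is the Borel sigma-algebra of R^n * R^r. *)
HB.instance Definition _ (R : realType) (m n : nat) :=
  @isMeasurable.Build (sigma_display (@open 'M[R]_(m, n))) 'M[R]_(m, n)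
    <<s @open 'M[R]_(m, n) >>
    (@sigma_algebra0 _ setT (@open 'M[R]_(m, n)))
    (@sigma_algebraC 'M[R]_(m, n) (@open 'M[R]_(m, n)))
    (@sigma_algebra_bigcup _ setT (@open 'M[R]_(m, n))).

Section polynomials.
Context {R : realType} {n r : nat}.

(* R[x] and R[x, lambda]: the first n variables of R[x, lambda] are the x_i,
   the last r are the lambda_k. *)
Local Notation polyx := (mpoly n R).
Local Notation polyxl := (mpoly (n + r) R).

Definition lambda_var (k : 'I_r) : polyxl := mpolyX R (mnm1 (rshift n k)).

(* the inclusion of R[x] into R[x, lambda] *)
Definition inclx (p : polyx) : polyxl :=
  comp_mpoly [tuple mpolyX R (mnm1 (lshift r i)) | i < n] p.

Definition Vr (p : polyxl) : Prop :=
  exists (p0 : polyx) (q : 'I_r -> polyx),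
    p = inclx p0 + \sum_(k < r) lambda_var k * inclx (q k).

Definition sos (s : polyx) : Prop :=
  exists qs : seq polyx, s = \sum_(q <- qs) q ^+ 2.

Definition qmodule_x {m : nat} (g : 'I_m -> polyxl) (p : polyxl) : Prop :=
  exists (s0 : polyx) (s : 'I_m -> polyx),
    [/\ sos s0, forall i, sos (s i) &
        p = inclx s0 + \sum_(i < m) inclx (s i) * g i].

Definition restricted_archimedean {m : nat} (g : 'I_m -> polyxl) : Prop :=
  forall p, Vr p -> exists N : R,
    [/\ 0 < N, qmodule_x g (mpolyC (n + r) N + p) &
        qmodule_x g (mpolyC (n + r) N - p)].

Definition evalxl (p : polyxl) (x : 'rV[R]_n) (l : 'rV[R]_r) : R :=
  meval (row_mx x l 0) p.

Definition monomx (x : 'rV[R]_n) (a : multinom n) : R :=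
  \prod_(i < n) x 0 i ^+ a i.

Definition Lambda {m : nat} (g : 'I_m -> polyxl) (x : 'rV[R]_n) :
  set 'rV[R]_r := [set l | forall i, 0 <= evalxl (g i) x l].

Definition Kset {m : nat} (g : 'I_m -> polyxl) :
  set ('rV[R]_n * 'rV[R]_r) :=
  [set u | forall i, 0 <= evalxl (g i) u.1 u.2].

End polynomials.

Definition msupport {R : realType} {n : nat}
    (nu : {measure set 'rV[R]_n -> \bar R}) : set 'rV[R]_n :=
  [set x | forall U : set 'rV[R]_n, open U -> U x -> (0 < nu U)%E].

Section measures.
Context {R : realType} {n r m : nat}.
Variable g : 'I_m -> mpoly (n + r) R.

(* A Borel probability measure on K is encoded as one on R^n * R^r giving mass
   1 to K.  The integrals are extended-real valued, so each equation with a
   real number also entails that its integrand is integrable. *)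
Definition represents (rho : probability ('rV[R]_n * 'rV[R]_r)%type R)
    (y : multinom n -> R) (z : 'I_r -> multinom n -> R) : Prop :=
  (forall a, (\int[rho]_(u in Kset g) (monomx u.1 a)%:E = (y a)%:E)%E) /\
  (forall k a,
     (\int[rho]_(u in Kset g) (monomx u.1 a * u.2 0 k)%:E = (z k a)%:E)%E).

Definition graph_data (y : multinom n -> R)
    (z : 'I_r -> multinom n -> R)
    (mu : probability 'rV[R]_n R) (tau : 'rV[R]_n -> 'rV[R]_r) : Prop :=
  [/\ compact (msupport mu),
      forall k, (fun x => tau x 0 k) \in Lfun mu +oo%E,
      forall a, (\int[mu]_x (monomx x a)%:E = (y a)%:E)%E,
      forall k a, (\int[mu]_x (monomx x a * tau x 0 k)%:E = (z k a)%:E)%E &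
      {ae mu, forall x, Kset g (x, tau x)}].

(* rho(dx, dlambda) = mu(dx) pi_x(dlambda) *)
Definition disintegration (rho : probability ('rV[R]_n * 'rV[R]_r)%type R)
    (mu : probability 'rV[R]_n R) (pi : R.-pker 'rV[R]_n ~> 'rV[R]_r) : Prop :=
  forall A : set ('rV[R]_n * 'rV[R]_r), measurable A ->
    (rho A = \int[mu]_x pi x (xsection A x))%E.

Definition has_barycenter (x : 'rV[R]_n)
    (nu : {measure set 'rV[R]_r -> \bar R}) (t : 'rV[R]_r) : Prop :=
  forall k, (\int[nu]_(l in Lambda g x) (l 0 k)%:E = (t 0 k)%:E)%E.

End measures.

(* Main.v *)
Require Import Defs.
From HB Require Import structures.
From mathcomp Require Import all_boot all_order all_algebra.
From mathcomp Require mpoly.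
Import -(notations) mpoly.
From mathcomp Require Import all_classical all_reals all_analysis.
From mathcomp Require Import measurable_realfun ring lra.

Set Implicit Arguments.
Unset Strict Implicit.
Unset Printing Implicit Defensive.
Import Order.TTheory GRing.Theory Num.Theory.
Import numFieldNormedType.Exports.

Local Open Scope classical_set_scope.
Local Open Scope ring_scope.
(** Evaluating the certificates [N ± x_i] and [N ± lambda_k] on [K] shows that
    [K] is bounded.

    Moments determine weighted measures on a box [[-N, N]^n]: if [v] is mapped
    affinely to [s] in [[0, 1]] with [a] going to [1/2], then the polynomials
    [(1 - s^j)^(j 2^j)] converge boundedly to the indicator of [v < a], so by
    dominated convergence equal moments give equal integrals over open
    orthants, which form a pi-system generating the Borel sets.  With weight 1
    this identifies the x-marginal of a representing measure with [mu]; with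
    weights [lambda_k] and [tau_k] it identifies the conditional barycenters
    with [tau].

    Kernels come from a disintegration theorem for [X * R^r] with [X] an
    arbitrary measurable space.  On the line, Radon-Nikodym derivatives [G_q] of
    [A |-> rho (A x [-oo, q[)], [q] rational, define the quantile function
    [inf {q | u < G_q(x)}], whose law under uniform [u] is the conditional law;
    products are handled by composing kernels.

    The mass of [K] is 1 exactly when [pi_x] charges only [Lambda(x)] for almost
    every [x], and [Lambda(x)] is closed. *)

(** * Probability kernels and disintegration *)

(** Bundling step: kernels below are built pointwise, and later proofs only use the resulting value
    equation. *)
Lemma pker_ex d1 d2 (X : measurableType d1) (Y : measurableType d2)
    (R : realType) (k : X -> {measure set Y -> \bar R}) :
  (forall U, measurable U -> measurable_fun setT (k ^~ U)) ->
  (forall x, k x setT = 1%E) ->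
  exists k' : R.-pker X ~> Y, forall x, k' x = k x.
Proof.
move=> mk k1.
pose m1 := isKernel.Build _ _ _ _ _ k mk.
pose k_ : R.-ker X ~> Y := HB.pack k m1.
pose m2 := Kernel_isProbability.Build _ _ _ _ _ k_ k1.
pose k' : R.-pker X ~> Y := HB.pack k m1 m2.
by exists k'.
Qed.

Lemma pushforward_measure_ex d1 d2 (X : measurableType d1)
    (Y : measurableType d2) (R : realType) (m : {measure set X -> \bar R})
    (f : X -> Y) : measurable_fun setT f ->
  {m' : {measure set Y -> \bar R} | forall A, m' A = m (f @^-1` A)}.
Proof.
move=> mf.
by exists (measure_function_pushforward__canonical__measure_function_Measure m mf).
Qed.

Lemma measurable_pker_xsection d1 d2 (X : measurableType d1)
    (Y : measurableType d2) (R : realType) (k : R.-pker X ~> Y)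
    (A : set (X * Y)) :
  measurable A -> measurable_fun setT (fun x => k x (xsection A x)).
Proof.
by move=> mA; apply: measurable_fun_xsection_finite_kernel; rewrite inE.
Qed.

Section pker_map.
Context d1 d2 d3 d4 (W : measurableType d1) (X : measurableType d2)
  (Y : measurableType d3) (Z : measurableType d4) (R : realType).

Lemma pker_map (k : R.-pker X ~> Y) (h : W -> X) (f : W * Y -> Z) :
  measurable_fun setT h -> measurable_fun setT f ->
  exists k' : R.-pker W ~> Z, forall w U,
    k' w U = k (h w) [set y | U (f (w, y))].
Proof.
move=> mh mf.
have mfw w : measurable_fun setT (fun y => f (w, y)) by exact: measurableT_comp.
pose kf w := projT1 (pushforward_measure_ex (k (h w)) (mfw w)).
have kfE w U : kf w U = k (h w) [set y | U (f (w, y))].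
  by rewrite /kf; case: pushforward_measure_ex => m' /= ->.
have [||k' k'E] := pker_ex (k := kf); last by exists k' => w U; rewrite k'E kfE.
- move=> U mU; under eq_fun do rewrite kfE.
  have [||kh khE] := pker_ex (k := fun w => k (h w)).
  + move=> V mV; apply: (measurableT_comp (f := k ^~ V)) => //.
    exact: measurable_kernel.
  + by move=> w; rewrite prob_kernel.
  have mA : measurable (f @^-1` U) by rewrite -[_ @^-1` _]setTI; exact: mf.
  have := measurable_pker_xsection kh mA.
  apply: eq_measurable_fun => w _.
  by rewrite khE xsectionE.
- by move=> w; rewrite kfE; exact: (prob_kernel (s := k)).
Qed.

End pker_map.

Section pker_integral.
Context d1 d2 (X : measurableType d1) (Y : measurableType d2) (R : realType).

(* The measure [rho] is the composition of a constant kernel with the kernel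
   sending [x] to the law of [(x, y)], [y ~ k x]. *)
Lemma ge0_integral_disintegration (mu : probability X R)
    (rho : {measure set (X * Y) -> \bar R}) (k : R.-pker X ~> Y)
    (f : X * Y -> \bar R) :
  (forall A, measurable A -> rho A = \int[mu]_x k x (xsection A x))%E ->
  measurable_fun setT f -> (forall u, 0 <= f u)%E ->
  (\int[rho]_u f u = \int[mu]_x \int[k x]_y f (x, y))%E.
Proof.
move=> rhoE mf f0.
have [k1 k1E] := @pker_map _ _ _ _ (unit * X)%type X Y (X * Y)%type R k snd
  (fun p => (p.1.2, p.2)) measurable_snd
  ltac:(apply: measurable_fun_pair => //; exact: measurableT_comp).
have [||l lE] := @pker_ex _ _ unit X R (fun=> mu).
- by move=> U mU; exact: measurable_cst.
- by move=> x; exact: (@probability_setT _ _ _ mu).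
have lint g : (\int[l tt]_x g x = \int[mu]_x g x)%E by rewrite lE.
rewrite -[RHS]lint; transitivity (\int[kcomp l k1 tt]_z f z)%E.
  apply: eq_measure_integral => A mA _.
  rewrite /= rhoE// -lint; apply: eq_integral => x _.
  by rewrite k1E/= xsectionE.
rewrite integral_kcomp//; apply: eq_integral => x _.
have [m mE] := pushforward_measure_ex (k x) (pair1_measurable x).
transitivity (\int[m]_z f z)%E.
  by apply: eq_measure_integral => A mA _; rewrite mE k1E.
transitivity (\int[pushforward (k x) (pair x)]_z f z)%E.
  by apply: eq_measure_integral => A mA _; rewrite mE.
by rewrite ge0_integral_pushforward.
Qed.

End pker_integral.

(** The base [X] ranges over all measurable spaces, so that a product [Y * Z] can be treated by
    disintegrating [Z] over the larger base [X * Y]. *)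
Definition disintegrable (R : realType) d (Y : measurableType d) : Prop :=
  forall d' (X : measurableType d') (rho : probability (X * Y)%type R)
    (mu : probability X R),
  (forall A, measurable A -> rho (fst @^-1` A) = mu A) ->
  exists k : R.-pker X ~> Y,
    forall A, measurable A -> rho A = (\int[mu]_x k x (xsection A x))%E.

Lemma probability_pushforward_ex d1 d2 (X : measurableType d1)
    (Y : measurableType d2) (R : realType) (m : probability X R)
    (f : X -> Y) : measurable_fun setT f ->
  {m' : probability Y R | forall A, m' A = m (f @^-1` A)}.
Proof.
move=> mf.
pose mf' := isMeasurableFun.Build _ _ _ _ _ mf.
pose f' : {mfun X >-> Y} := HB.pack f mf'.
by exists (distribution m f').
Qed.

(** The law is transported along [phi], disintegrated over [Z], and the kernel is brought back by
    [psi]; the cancellation [psi (phi y) = y] recovers the original law. *)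
Lemma disintegrable_retract (R : realType) d1 d2 (Y : measurableType d1)
    (Z : measurableType d2) (phi : Y -> Z) (psi : Z -> Y) :
  measurable_fun setT phi -> measurable_fun setT psi -> cancel phi psi ->
  disintegrable R Z -> disintegrable R Y.
Proof.
move=> mphi mpsi phiK dZ d X rho mu rhomu.
have [rho' rho'E] := probability_pushforward_ex (f := fun u => (u.1, phi u.2)) rho
  ltac:(apply: measurable_fun_pair => //; exact: measurableT_comp).
have [|k kE] := dZ _ X rho' mu.
  by move=> A mA; rewrite rho'E -rhomu.
have [k' k'E] := pker_map (f := fun u => psi u.2) k (@measurable_id _ _ setT)
  ltac:(exact: measurableT_comp).
exists k' => A mA.
transitivity (rho' [set u | A (u.1, psi u.2)]).
  rewrite rho'E; congr (rho _); apply/seteqP.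
  by split => -[x y]/=; rewrite phiK.
rewrite kE; first by apply: eq_integral => x _; rewrite k'E !xsectionE.
rewrite -[X in measurable X]setTI.
have : measurable_fun setT (fun u : X * Z => (u.1, psi u.2)).
  by apply: measurable_fun_pair => //; exact: measurableT_comp.
exact.
Qed.

(** Chain rule for conditional laws: draw [y] given [x], then [z] given [(x, y)]. *)
Lemma disintegrable_prod (R : realType) d1 d2 (Y : measurableType d1)
    (Z : measurableType d2) :
  disintegrable R Y -> disintegrable R Z -> disintegrable R (Y * Z)%type.
Proof.
move=> dY dZ d X rho mu rhomu.
have mfs : measurable_fun setT (fun u : X * (Y * Z) => u.2.1).
  by apply: measurableT_comp => //; exact: measurable_fst.
have mss : measurable_fun setT (fun u : X * (Y * Z) => u.2.2).
  by apply: measurableT_comp => //; exact: measurable_snd.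
(* [rho1] is the law of [(x, y)] and [rho2] that of [((x, y), z)], whose first marginal is
   [rho1]. *)
have [rho1 rho1E] := probability_pushforward_ex (f := fun u => (u.1, u.2.1)) rho
  ltac:(apply: measurable_fun_pair => //; exact: measurable_fst).
have [rho2 rho2E] :=
  probability_pushforward_ex (f := fun u => ((u.1, u.2.1), u.2.2)) rho
  ltac:(do 2 apply: measurable_fun_pair => //; exact: measurable_fst).
have [|k1 k1E] := dY _ X rho1 mu; first by move=> A mA; rewrite rho1E -rhomu.
have [|k2 k2E] := dZ _ _ rho2 rho1; first by move=> A mA; rewrite rho2E rho1E.
have mg : measurable_fun setT (fun u : X * Y * Z => (u.1.2, u.2)).
  by apply: measurable_fun_pair => //; exact: measurableT_comp.
have [k2' k2'E] := pker_map k2 (@measurable_id _ _ setT) mg.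
have [||k kE] := pker_ex (k := mkcomp k1 k2').
- by move=> U mU; exact: measurable_kernel.
- move=> x; rewrite /= /kcomp.
  under eq_integral do rewrite prob_kernel.
  by rewrite integral_cst// prob_kernel mule1.
exists k => A mA.
have mA' : measurable [set u : X * Y * Z | A (u.1.1, (u.1.2, u.2))].
  have : measurable_fun setT (fun u : X * Y * Z => (u.1.1, (u.1.2, u.2))).
    apply: measurable_fun_pair => //.
    by apply: measurableT_comp => //; exact: measurable_fst.
  by move=> /(_ measurableT _ mA); rewrite setTI.
transitivity (rho2 [set u | A (u.1.1, (u.1.2, u.2))]).
  rewrite rho2E; congr (rho _); apply/seteqP.
  by split => -[x [y z]].
rewrite k2E// (ge0_integral_disintegration k1E)//; last first.
  exact: measurable_pker_xsection.
apply: eq_integral => x _; rewrite kE; apply: eq_integral => y _.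
by rewrite k2'E !xsectionE.
Qed.

Lemma finite_measure_ex d (X : measurableType d) (R : realType)
    (nu : {measure set X -> \bar R}) : fin_num_fun nu ->
  {nu' : {finite_measure set X -> \bar R} | forall A, nu' A = nu A}.
Proof.
move=> fnu.
pose k A := nu A.
pose m1 := isMeasure.Build _ _ _ k (measure0 nu) (measure_ge0 nu)
  (@measure_semi_sigma_additive _ _ _ nu).
pose k_ : {measure set X -> \bar R} := HB.pack k m1.
pose m2 := Measure_isFinite.Build _ _ _ k_ fnu.
pose nu' : {finite_measure set X -> \bar R} := HB.pack k m1 m2.
by exists nu'.
Qed.

(** The functions [g] and [max(f, g)] have the same integral over every measurable [A]: split [A]
    along the set where [g < f], on which the maximum is [f], with integral at most that of [g].
    Hence they agree almost everywhere. *)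
Lemma ge0_ae_le d (X : measurableType d) (R : realType)
    (mu : {measure set X -> \bar R}) (f g : X -> \bar R) :
  (forall x, 0 <= f x)%E -> (forall x, 0 <= g x)%E ->
  measurable_fun setT f -> mu.-integrable setT g ->
  (forall A, measurable A -> \int[mu]_(x in A) f x <= \int[mu]_(x in A) g x)%E ->
  {ae mu, forall x, (f x <= g x)%E}.
Proof.
move=> f0 g0 mf ig fg.
have mg := measurable_int _ ig.
have mh : measurable_fun setT (fun x => maxe (f x) (g x)) by exact: measurable_maxe.
pose B := [set x | (g x < f x)%E].
have mB : measurable B.
  by rewrite -[B]setTI; exact: measurable_lte.
suff : ae_eq mu setT g (fun x => maxe (f x) (g x)).
  by apply: filterS => x /= /(_ Logic.I) ->; rewrite le_max lexx.
apply: integral_ae_eq => // A _ mA; apply/eqP; rewrite eq_le; apply/andP; split.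
  apply: ge0_le_integral => //; try exact: measurable_funTS.
  by move=> x _; rewrite le_max lexx orbT.
have mAB : measurable (A `&` B) by exact: measurableI.
have mAB' : measurable (A `\` B) by exact: measurableD.
have AE : A = (A `&` B) `|` (A `\` B) by rewrite setUIDK.
have dAB : [disjoint A `&` B & A `\` B].
  by apply/disj_setPS => x [[_ Bx] [_ nBx]].
rewrite [in leLHS]AE [in leRHS]AE !ge0_integral_setU//;
  try (exact: measurable_funTS);
  try by move=> x _; rewrite le_max f0.
apply: leeD.
  rewrite [leLHS](_ : _ = \int[mu]_(x in A `&` B) f x)%E; first exact: fg.
  by apply: eq_integral => x /[!inE] -[_ /ltW/max_idPl].
rewrite [leLHS](_ : _ = \int[mu]_(x in A `\` B) g x)%E//.
by apply: eq_integral => x /[!inE] -[_ /negP]; rewrite -leNgt => /max_idPr.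
Qed.

(** [G] is a version of the conditional probability of [B] given [x]: the measure sending [A] to the
    mass of [A x B] is dominated by the marginal [mu], so Radon-Nikodym applies. *)
Lemma conditional_density_ex d1 d2 (X : measurableType d1)
    (Y : measurableType d2) (R : realType) (rho : probability (X * Y)%type R)
    (mu : probability X R) (B : set Y) :
  (forall A, measurable A -> rho (fst @^-1` A) = mu A) -> measurable B ->
  exists G : X -> \bar R, [/\ forall x, (0 <= G x)%E, mu.-integrable setT G &
    forall A, measurable A -> rho (A `*` B) = (\int[mu]_(x in A) G x)%E].
Proof.
move=> rhomu mB.
have mTB : measurable (setT `*` B : set (X * Y)) by exact: measurableX.
have [nu nuE] := pushforward_measure_ex (mrestr rho mTB) (@measurable_fst _ _ X Y).
have {}nuE A : nu A = rho (A `*` B).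
  rewrite nuE /mrestr; congr (rho _); apply/seteqP.
  by split => -[x y]/= [] // ? [].
have fnu : fin_num_fun nu.
  by move=> A mA; rewrite nuE fin_num_measure//; exact: measurableX.
have [nu' nu'E] := finite_measure_ex fnu.
have numu : nu' `<< mu.
  apply/null_content_dominatesP => A mA muA0; rewrite nu'E nuE.
  have rA0 : rho (fst @^-1` A) = 0%E by rewrite rhomu//; exact: muA0.
  apply/eqP; rewrite -measure_le0 -rA0; apply: le_measure.
  - by rewrite inE; exact: measurableX.
  - by rewrite inE -[X in measurable X]setTI; exact: measurable_fst.
  - by move=> [x y] [].
have [G [G0 iG GE]] := radon_nikodym_finite numu.
by exists G; split => // A mA; rewrite -nuE -nu'E GE.
Qed.

(** * Disintegration over the extended real line by quantiles *)

Section disintegrable_ereal.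
Context d (X : measurableType d) (R : realType)
  (rho : probability (X * \bar R)%type R) (mu : probability X R).
Hypothesis rhomu : forall A, measurable A -> rho (fst @^-1` A) = mu A.

Let ray (q : rat) : set \bar R := `]-oo, (ratr q)%:E[%classic.

Let mray q : measurable (ray q). Proof. exact: emeasurable_itv. Qed.

Let cid_G q := cid (conditional_density_ex rhomu (mray q)).

Let G q := projT1 (cid_G q).

Let G0 q x : (0 <= G q x)%E.
Proof. by rewrite /G; case: cid_G => f []. Qed.

Let iG q : mu.-integrable setT (G q).
Proof. by rewrite /G; case: cid_G => f []. Qed.

Let GE q A : measurable A -> rho (A `*` ray q) = (\int[mu]_(x in A) G q x)%E.
Proof. by rewrite /G; case: cid_G => f []; auto. Qed.

Let mG q : measurable_fun setT (G q).
Proof. exact: measurable_int (iG q). Qed.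

Let G_le1 : {ae mu, forall x q, (G q x <= 1)%E}.
Proof.
(* Enumerating the rationals by [unpickle] turns the quantifier over [q] into one over [nat], so
   that the countably many null sets merge into one. *)
have : forall n, {ae mu, forall x, forall q, unpickle n = Some q -> (G q x <= 1)%E}.
  move=> n; case: (unpickle n) => [q|]; last exact: aeW.
  suff : {ae mu, forall x, (G q x <= 1)%E} by apply: filterS => x ? _ [<-].
  apply: ge0_ae_le => //.
  - by apply: finite_measure_integrable_cst.
  - move=> A mA; rewrite -GE// integral_cst// mul1e.
    apply: (@le_trans _ _ (rho (fst @^-1` A))); last by rewrite rhomu.
    apply: le_measure.
    + by rewrite inE; exact: measurableX.
    + by rewrite inE -[X in measurable X]setTI; exact: measurable_fst.
    + by move=> [x y] [].
move=> /ae_foralln; apply: filterS => x Gx q.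
exact: (Gx (pickle q) _ (pickleK q)).
Qed.

Let G_nd : {ae mu, forall x p q, (p <= q)%R -> (G p x <= G q x)%E}.
Proof.
have : forall n, {ae mu, forall x, forall p q : rat, unpickle n = Some (p, q) ->
    (p <= q)%R -> (G p x <= G q x)%E}.
  move=> n; case: (unpickle n : option (rat * rat)) => [[p q]|]; last exact: aeW.
  have [pq|pq] := leP p q; last first.
    by apply: aeW => x _ _ [<- <-]; rewrite leNgt pq.
  suff : {ae mu, forall x, (G p x <= G q x)%E} by apply: filterS => x ? _ _ [<- <-].
  apply: ge0_ae_le => //.
  move=> A mA; rewrite -!GE//; apply: le_measure.
  - by rewrite inE; exact: measurableX.
  - by rewrite inE; exact: measurableX.
  - move=> [x y] [/= Ax]; rewrite /ray/= !in_itv/= => ylt; split => //.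
    by apply: lt_le_trans ylt _; rewrite lee_fin ler_rat.
move=> /ae_foralln; apply: filterS => x Gx p q.
exact: (Gx (pickle (p, q)) _ _ (pickleK (p, q))).
Qed.

(* No monotonicity of [q |-> G q x] is needed for [quantile_lt]. *)
Let quantile (xu : X * R) : \bar R :=
  ereal_inf [set (ratr q)%:E | q in [set q | (xu.2%:E < G q xu.1)%E]].

Let quantile_lt xu (t : R) : (quantile xu < t%:E)%E <->
  exists2 q, (ratr q < t)%R & (xu.2%:E < G q xu.1)%E.
Proof.
split; first by move=> /ereal_inf_lt[_ [q/= ? <-]]; rewrite lte_fin; exists q.
move=> [q qt uG]; apply: (@le_lt_trans _ _ (ratr q)%:E); last by rewrite lte_fin.
by apply: ereal_inf_lbound; exists q.
Qed.

Let mquantile : measurable_fun setT quantile.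
Proof.
apply: (measurability _ (ErealGenInftyO.measurableE R)) => _ /= [_ [t ->] <-].
rewrite setTI (_ : _ @^-1` _ = \bigcup_(q : rat)
    (if (ratr q < t)%R then [set xu | (xu.2%:E < G q xu.1)%E] else set0)).
  apply: bigcupT_measurable_rat => q; case: ifPn => // _.
  rewrite -[X in measurable X]setTI; apply: measurable_lte => //.
    by apply/measurable_EFinP.
  exact: measurableT_comp.
apply/seteqP; split => xu /=; rewrite in_itv/=.
  by move/quantile_lt => [q qt ?]; exists q => //; rewrite qt.
by move=> [q _]; case: ifPn => // qt ?; apply/quantile_lt; exists q.
Qed.

(* The library's uniform law lives on [measurableTypeR R], whose display differs
   from that of [R]. *)
Let idR : measurable_fun setT (fun u : measurableTypeR R => u : R).
Proof. exact: measurable_id. Qed.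

Let P_ex := probability_pushforward_ex (uniform_prob (@ltr01 R)) idR.

Let P : probability R R := projT1 P_ex.

Let P_ray (c : \bar R) : (0 <= c)%E -> (c <= 1)%E -> P [set u | (u%:E < c)%E] = c.
Proof.
case: c => [c| |]//; rewrite !lee_fin => c0 c1.
transitivity (\int[lebesgue_measure]_(x in [set u : R | (u%:E < c%:E)%E])
  (uniform_pdf 0 1 x)%:E)%E; first by rewrite /P; case: P_ex => p /= ->.
rewrite integral_uniform_pdf.
rewrite (_ : _ `&` _ = `[0%R, c[%classic); last first.
  apply/seteqP; split => u /=; rewrite !in_itv/= lte_fin.
    by move=> [-> /andP[->]].
  by move=> /andP[-> uc]; rewrite uc (ltW (lt_le_trans uc c1)).
rewrite (eq_integral (cst 1%E)).
  rewrite integral_cst//= mul1e lebesgue_measure_itv/= lte_fin.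
  case: ltP => [_|c0']; first by rewrite sube0.
  by congr (_%:E); apply/eqP; rewrite eq_le c0 c0'.
move=> u; rewrite inE/= in_itv/= => /andP[u0 uc].
by rewrite /uniform_pdf u0 (ltW (lt_le_trans uc c1)) subr0 invr1.
Qed.

(** A sequence of rationals increasing strictly below [t] to [t]; since rays are open, [ray t] is
    the union of the rays at these points. *)
Let below (t : rat) (n : nat) : rat := t - n.+1%:R^-1.

Let below_nd t m n : (m <= n)%N -> below t m <= below t n.
Proof. by move=> mn; rewrite lerD2l lerN2 lef_pV2 ?posrE// ler_nat ltnS. Qed.

Let below_lt t n : below t n < t.
Proof. by rewrite ltrBlDr ltrDl invr_gt0. Qed.

Let below_ex t q : q < t -> exists n, q <= below t n.
Proof.
rewrite -(ltr_rat R) => /ltr_add_invr[n /ltW qn]; exists n.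
by rewrite lerBrDr -(ler_rat R) rmorphD/= fmorphV/= ratr_nat.
Qed.

(** The densities need not be left-continuous in [q], so the law of the quantile on [ray t] is
    identified with the left limit of [G] at [t] and not with [G t x]. *)
Let P_quantile (t : rat) : {ae mu, forall x,
  (fun n => G (below t n) x) @ \oo --> P [set u | ray t (quantile (x, u))]}.
Proof.
apply: filterS2 G_le1 G_nd => x G1 Gnd.
(* By monotonicity of [G] in [q], the union over all rationals below [t] reduces to an increasing
   union along [below t]. *)
rewrite (_ : [set u | _] = \bigcup_n [set u | (u%:E < G (below t n) x)%E]).
  rewrite [X in X @ \oo --> _](_ : _ =
      P \o (fun n => [set u | (u%:E < G (below t n) x)%E])); last first.
    by apply/funext => n /=; rewrite P_ray.
  have mE n : measurable [set u : R | (u%:E < G (below t n) x)%E].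
    rewrite -[X in measurable X]setTI; exact: measurable_lte.
  apply: (nondecreasing_cvg_mu (mu := P)) => //; first exact: bigcup_measurable.
  move=> m n mn; apply/subsetPset => u /= /lt_le_trans; apply.
  exact/Gnd/below_nd.
apply/seteqP; split => u /=; rewrite /ray/= in_itv/=.
  move/quantile_lt => [q]; rewrite ltr_rat => /below_ex[n qn] uq.
  by exists n => //=; apply: lt_le_trans uq _; exact: Gnd.
by move=> [n _] /= uG; apply/quantile_lt; exists (below t n); rewrite ?ltr_rat.
Qed.

Let mXq : measurable_fun setT (fun xu : X * R => (xu.1, quantile xu)).
Proof. by apply: measurable_fun_pair. Qed.

(** The law of [(x, quantile (x, u))] with [x] drawn from [mu] and [u] uniform and independent; it
    has an explicit kernel, and it remains to identify it with [rho]. *)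
Let mu2 := projT1 (pushforward_measure_ex (mu \x P)%E mXq).

Let mu2E A : mu2 A = (\int[mu]_x P [set u | A (x, quantile (x, u))])%E.
Proof.
rewrite /mu2; case: pushforward_measure_ex => m /= ->.
by apply: eq_integral => x _; rewrite /= xsectionE.
Qed.

Let mu2X A B : measurable A -> measurable B ->
  mu2 (A `*` B) = (\int[mu]_(x in A) P [set u | B (quantile (x, u))])%E.
Proof.
move=> mA mB; rewrite mu2E [RHS]integral_mkcond.
apply: eq_integral => x _; rewrite patchE; case: ifPn => [/set_mem Ax|/negP xA].
  by congr (P _); apply/seteqP; split => [u []//|u].
rewrite -[RHS](measure0 P); congr (P _).
by apply/seteqP; split => u // -[Ax _]; apply: xA; exact: mem_set.
Qed.

(** Both sides are the limit of the integrals over [A] of [G (below t n)]: on the left by continuity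
    of [rho] from below, on the right by dominated convergence with bound 1. *)
Let rho_mu2_ray (A : set X) t : measurable A ->
  rho (A `*` ray t) = mu2 (A `*` ray t).
Proof.
move=> mA; rewrite mu2X//.
have rayE : ray t = \bigcup_n ray (below t n).
  apply/seteqP; split => y; rewrite /ray/= in_itv/=.
    case: y => [y| |]//; last first.
      by exists 0%N => //=; rewrite in_itv/= ltNyr.
    rewrite lte_fin => /rat_in_itvoo[q]; rewrite in_itv/= => /andP[yq].
    rewrite ltr_rat => /below_ex[n qn]; exists n => //=.
    by rewrite in_itv/= lte_fin (lt_le_trans yq)// ler_rat.
  move=> [n _]; rewrite /= in_itv/= => /lt_trans; apply.
  by rewrite lte_fin ltr_rat.
have cvg_rho : (fun n => \int[mu]_(x in A) G (below t n) x)%E @ \oo -->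
    rho (A `*` ray t).
  rewrite rayE setX_bigcupr (_ : (fun n => _) =
      rho \o (fun n => A `*` ray (below t n))).
    apply: (nondecreasing_cvg_mu (mu := rho)).
    - by move=> n; exact: measurableX.
    - by apply: bigcup_measurable => n _; exact: measurableX.
    - move=> m n mn; apply/subsetPset => -[x y] [/= Ax]; rewrite /ray/= !in_itv/=.
      move=> yt; split => //; apply: lt_le_trans yt _.
      by rewrite lee_fin ler_rat below_nd.
  by apply/funext => n /=; rewrite GE.
have [|||||_ _] := @dominated_convergence _ _ _ mu A mA
  (fun n => G (below t n)) (fun x => P [set u | ray t (quantile (x, u))]) (cst 1%E).
- by move=> n; exact: measurable_funTS.
- apply: measurable_funTS.
  have mQ : measurable (quantile @^-1` ray t).
    by rewrite -[X in measurable X]setTI; exact: mquantile.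
  have := measurable_fun_xsection P mQ.
  by apply: eq_measurable_fun => x _; rewrite /= xsectionE.
- by apply: filterS (P_quantile t) => x.
- exact: finite_measure_integrable_cst.
- apply: filterS G_le1 => x G1 n _.
  by rewrite gee0_abs.
by move=> cvg_P; apply: cvg_unique cvg_rho cvg_P.
Qed.

(** Rectangles over rays form a pi-system that generates the product sigma-algebra, so agreement on
    them suffices. *)
Let rho_mu2 A : measurable A -> rho A = mu2 A.
Proof.
(* Every [ray q] misses [+oo]; adding [setT] makes the rectangles cover the space and contain all
   [A x setT]. *)
pose rays : set (set \bar R) := [set B | B = setT \/ exists q, B = ray q].
pose C := [set A `*` B | A in @measurable _ X & B in rays].
have mrays B : rays B -> measurable B by case=> [->//|[q ->]].
have raysE : @measurable _ (\bar R) = <<s rays >>.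
  apply/seteqP; split; last first.
    by apply: smallest_sub => //; exact: sigma_algebra_measurable.
  rewrite [X in X `<=` _]ErealGenInftyO.measurableE.
  apply: smallest_sub; first exact: smallest_sigma_algebra.
  move=> _ [r ->].
  rewrite (_ : `]-oo, r%:E[%classic =
      \bigcup_(q : rat) if ratr q < r then ray q else set0).
    apply: (@bigcupT_measurable_rat _ (g_sigma_algebraType rays)) => q.
    case: ifPn => // _; apply: sub_sigma_algebra; right; by exists q.
  apply/seteqP; split => y; rewrite /=.
    case: y => [y| |]; rewrite in_itv/= //; last first.
      (* The point [-oo] lies in every ray, so any rational below [r] serves. *)
      have /rat_in_itvoo[q] : r - 1 < r by rewrite ltrBlDr ltrDl.
      rewrite in_itv/= => /andP[_ qr] _; exists q => //.
      by rewrite qr /ray/= in_itv/= ltNyr.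
    rewrite lte_fin => /rat_in_itvoo[q]; rewrite in_itv/= => /andP[yq qr].
    by exists q => //; rewrite qr /ray/= in_itv/= lte_fin.
  move=> [q _]; case: ifPn => // qr; rewrite /ray/= !in_itv/= => /lt_trans; apply.
  by rewrite lte_fin.
have raysI : setI_closed rays.
  move=> _ _ [->|[p ->]] [->|[q ->]]; rewrite ?setTI ?setIT.
  - by left.
  - by right; exists q.
  - by right; exists p.
  - right; exists (Num.min p q).
    apply/seteqP; split => y; rewrite /ray/= !in_itv/=.
      by case: (leP p q) => _ [].
    by case: (leP p q) => pq y_lt; split => //; apply: lt_le_trans y_lt _;
      rewrite lee_fin ler_rat// ltW.
move: A; apply: (@measure_unique _ _ _ C (fun=> setT)).
- apply/seteqP; split; last first.
    apply: smallest_sub; first exact: sigma_algebra_measurable.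
    by move=> _ [A mA [B /mrays mB <-]]; exact: measurableX.
  apply: smallest_sub; first exact: smallest_sigma_algebra.
  rewrite subUset; split.
    move=> _ [A mA <-]; rewrite setTI; apply: sub_sigma_algebra.
    by exists A => //; exists setT; [left|rewrite setXT].
  have : measurable_fun setT (snd : g_sigma_algebraType C -> \bar R).
    apply: (measurability _ raysE) => _ /= [B raysB <-]; rewrite setTI.
    apply: sub_sigma_algebra; exists setT => //; exists B => //.
    by rewrite setTX.
  by move=> msnd _ [B mB <-]; exact: msnd.
- move=> _ _ [A mA [B rB <-]] [A' mA' [B' rB' <-]].
  exists (A `&` A'); first exact: measurableI.
  by exists (B `&` B'); [exact: raysI|rewrite setXI].
- by move=> n; exists setT => //; exists setT; [left|rewrite setXTT].
- by rewrite bigcup_const//; exists 0%N.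
- move=> _ [A mA [B [->|[q ->]] <-]]; last exact: rho_mu2_ray.
  transitivity (mu A); first by rewrite setXT; exact: rhomu.
  rewrite mu2X// (eq_integral (cst 1%E)); first by rewrite integral_cst// mul1e.
  by move=> x _; exact: (probability_setT P).
- move=> n; apply: (@le_lt_trans _ _ 1%E); last exact: ltry.
  exact: probability_le1.
Qed.

Lemma disintegration_ereal : exists k : R.-pker X ~> \bar R,
  forall A, measurable A -> rho A = (\int[mu]_x k x (xsection A x))%E.
Proof.
(* The uniform law is viewed as a constant kernel; the required kernel sends [x] to the law of
   [quantile (x, u)]. *)
have [||kP kPE] := @pker_ex _ _ unit R R (fun=> P).
- by move=> U mU; exact: measurable_cst.
- by move=> x; exact: (@probability_setT _ _ _ P).
have [k kE] := @pker_map _ _ _ _ X unit R (\bar R) R kP (fun=> tt) quantile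
  (measurable_cst _) mquantile.
exists k => A mA; rewrite rho_mu2// mu2E; apply: eq_integral => x _.
by rewrite kE kPE xsectionE.
Qed.

End disintegrable_ereal.

Lemma disintegrable_ereal (R : realType) : disintegrable R (\bar R).
Proof. by move=> d X rho mu; exact: disintegration_ereal. Qed.

(** * Borel sets of R^n and polynomial maps *)

Lemma open_measurable_rV (R : realType) n (U : set 'rV[R]_n) :
  open U -> measurable U.
Proof. exact: sub_sigma_algebra. Qed.

Lemma continuous_measurable_rV (R : realType) n (f : 'rV[R]_n -> R) :
  continuous f -> measurable_fun setT f.
Proof.
move=> /continuousP cf; apply: (measurability _ (RGenOpens.measurableE R)).
move=> _ [_ [a [b ->]] <-]; rewrite setTI.
by apply: open_measurable_rV; apply: cf; exact: itv_open.
Qed.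

Lemma measurable_coord (R : realType) n (i : 'I_n) :
  measurable_fun setT (fun v : 'rV[R]_n => v 0 i).
Proof. by apply: continuous_measurable_rV => v; exact: coord_continuous. Qed.

(* Every open set is a countable union of boxes with rational endpoints. *)
Lemma measurable_rV d (X : measurableType d) (R : realType) n
    (f : X -> 'rV[R]_n) :
  (forall i, measurable_fun setT (fun x => f x 0 i)) -> measurable_fun setT f.
Proof.
move=> mf.
apply: (measurability (@open 'rV[R]_n)) => // _ [U oU <-]; rewrite setTI.
pose box (q : {ffun 'I_n -> rat * rat}) : set 'rV[R]_n :=
  [set v | forall i, ratr (q i).1 < v 0 i < ratr (q i).2].
rewrite (_ : f @^-1` U =
    \bigcup_q (if pselect (box q `<=` U) then f @^-1` box q else set0)).
  apply: countable_bigcupT_measurable => [|q]; first exact: countableP.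
  case: pselect => //= bU.
  rewrite (_ : f @^-1` box q =
      \bigcap_(i in [set: 'I_n])
        (fun x => f x 0 i) @^-1` `]ratr (q i).1, ratr (q i).2[).
    apply: fin_bigcap_measurable => // i _.
    by rewrite -[X in measurable X]setTI; apply: mf => //; exact: measurable_itv.
  apply/seteqP; split => x /=.
    by move=> fx i _ /=; rewrite in_itv/=; exact: fx.
  by move=> fx i; have := fx i Logic.I; rewrite /= in_itv.
apply/seteqP; split => x /=; last first.
  by move=> [q _]; case: pselect => //= qU; exact: (qU (f x)).
move=> Ux.
have /nbhs_ballP[e /= e0 eU] : nbhs (f x) U by exact: open_nbhs_nbhs.
have /choice[p pP] (i : 'I_n) : exists p : rat * rat,
    f x 0 i - e < ratr p.1 < f x 0 i /\ f x 0 i < ratr p.2 < f x 0 i + e.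
  have /rat_in_itvoo[q1] : f x 0 i - e < f x 0 i by rewrite ltrBlDr ltrDl.
  have /rat_in_itvoo[q2] : f x 0 i < f x 0 i + e by rewrite ltrDl.
  by rewrite !in_itv/= => ? ?; exists (q1, q2).
exists (finfun p) => //; case: pselect => [? i|[]]/=.
  by rewrite ffunE; case: (pP i) => /andP[_ ->] /andP[->].
move=> v bv; apply: eU; split => // i j; rewrite (ord1 i).
have /andP[] := bv j; rewrite ffunE => v1 v2.
have [/andP[p1 _] /andP[_ p2]] := pP j.
by rewrite /ball/= distrC ltr_distl (lt_trans p1 v1) (lt_trans v2 p2).
Qed.

(** Induction on [n]: R^(n+1) is a measurable retract of the product of the extended line and R^n,
    [fine] undoing the embedding of R; the one-point space R^0 is a retract of the extended line. *)
Lemma disintegrable_rV (R : realType) n : disintegrable R 'rV[R]_n.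
Proof.
elim: n => [|n IHn].
  apply: (@disintegrable_retract R _ _ 'rV[R]_0 (\bar R)
    (fun=> 0%E) (fun=> 0)) => //.
  - by move=> v; apply/rowP => -[].
  - exact: disintegrable_ereal.
pose phi (v : 'rV[R]_n.+1) := ((v 0 ord0)%:E, \row_i v 0 (lift ord0 i)).
pose psi (u : \bar R * 'rV[R]_n) : 'rV[R]_n.+1 :=
  \row_i (if unlift ord0 i is Some j then u.2 0 j else fine u.1).
apply: (disintegrable_retract (phi := phi) (psi := psi)).
- apply: measurable_fun_pair.
    by apply/measurable_EFinP; exact: measurable_coord.
  apply: measurable_rV => i; under eq_fun do rewrite mxE.
  exact: measurable_coord.
- apply: measurable_rV => i; under eq_fun do rewrite mxE.
  case: unliftP => [j _|_].
    by apply: (measurableT_comp (f := fun v : 'rV[R]_n => v 0 j)) => //;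
      exact: measurable_coord.
  exact: (measurableT_comp (f := fine)).
- move=> v; apply/rowP => i; rewrite !mxE.
  by case: unliftP => [j ->|->]; rewrite ?mxE.
- by apply: disintegrable_prod => //; exact: disintegrable_ereal.
Qed.

Definition orthant (R : realType) n (a : 'I_n -> R) : set 'rV[R]_n :=
  [set v | forall i, v 0 i < a i].

Lemma measurable_orthant (R : realType) n (a : 'I_n -> R) :
  measurable (orthant a).
Proof.
rewrite (_ : orthant a = \bigcap_(i in [set: 'I_n])
    (fun v : 'rV[R]_n => v 0 i) @^-1` `]-oo, a i[).
  apply: fin_bigcap_measurable => // i _; rewrite -[X in measurable X]setTI.
  by apply: measurable_coord => //; exact: measurable_itv.
apply/seteqP; split => v av i.
  by move=> _; rewrite /= in_itv/=; exact: av.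
by have := av i Logic.I; rewrite /= in_itv.
Qed.

(** Since [measurable_rV] holds for maps from any measurable space, it is enough that each
    coordinate is measurable for the sigma-algebra generated by orthants, and a half-space is a
    countable union of orthants. *)
Lemma measurable_rV_orthant (R : realType) n :
  @measurable _ 'rV[R]_n = <<s range (@orthant R n) >>.
Proof.
apply/seteqP; split; last first.
  apply: smallest_sub; first exact: sigma_algebra_measurable.
  by move=> _ [a _ <-]; exact: measurable_orthant.
pose T := g_sigma_algebraType (range (@orthant R n)).
suff : measurable_fun setT (id : T -> 'rV[R]_n).
  by move=> mid B mB; have := mid measurableT B mB; rewrite setTI.
apply: measurable_rV => i.
apply: (measurability _ (RGenInftyO.measurableE R)) => _ [_ [t ->] <-].
rewrite setTI (_ : _ @^-1` _ = \bigcup_(k : nat)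
    orthant (fun j => if j == i then t else k%:R)).
  apply: (@bigcupT_measurable _ T) => k; apply: sub_sigma_algebra.
  by exists (fun j => if j == i then t else k%:R).
apply/seteqP; split => v /=; rewrite in_itv/=.
  (* An integer above the sum of all [|v_j|] exceeds every coordinate. *)
  move=> vt; exists (Num.truncn (\sum_j `|v 0 j|)).+1 => // j.
  case: eqP => [->//|_]; apply: le_lt_trans (truncnS_gt _).
  rewrite (bigD1 j)//= (le_trans (ler_norm _))// lerDl.
  by apply: sumr_ge0 => ? _; rewrite normr_ge0.
by move=> [k _ /(_ i)]; rewrite eqxx.
Qed.

Lemma orthant_setI (R : realType) n : setI_closed (range (@orthant R n)).
Proof.
move=> _ _ [a _ <-] [b _ <-]; exists (fun i => Num.min (a i) (b i)) => //.
apply/seteqP; split => v /=.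
  by move=> vab; split => i; have := vab i; rewrite lt_min => /andP[].
by move=> [va vb] i; rewrite lt_min va vb.
Qed.

Lemma continuous_sum (R : realType) (T : topologicalType) I (s : seq I)
    (f : I -> T -> R) :
  (forall i, continuous (f i)) -> continuous (fun t => \sum_(i <- s) f i t).
Proof.
move=> cf; elim: s => [|i s IHs] t.
  by under eq_fun do rewrite big_nil; exact: cvg_cst.
under eq_fun do rewrite big_cons.
by apply: continuousD; [exact: cf|exact: IHs].
Qed.

Lemma continuous_prod (R : realType) (T : topologicalType) I (s : seq I)
    (f : I -> T -> R) :
  (forall i, continuous (f i)) -> continuous (fun t => \prod_(i <- s) f i t).
Proof.
move=> cf; elim: s => [|i s IHs] t.
  by under eq_fun do rewrite big_nil; exact: cvg_cst.
under eq_fun do rewrite big_cons.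
by apply: continuousM; [exact: cf|exact: IHs].
Qed.

(** * Polynomial evaluation, boundedness and measurability of K *)

Section polynomial_evaluation.
Context (R : realType) (n r : nat).
Implicit Types (x : 'rV[R]_n) (l : 'rV[R]_r).

Lemma evalxl_sum p x l :
  evalxl p x l = \sum_(a <- msupp p) mcoeff a p *
    \prod_i (row_mx x l 0 i) ^+ (a : multinom (n + r)) i.
Proof. exact: mevalE. Qed.

Lemma measurable_row_mx :
  measurable_fun setT (fun u : 'rV[R]_n * 'rV[R]_r => row_mx u.1 u.2).
Proof.
apply: measurable_rV => i; under eq_fun do rewrite mxE.
case: splitP => j _.
  exact: (measurableT_comp (@measurable_coord R n j)).
exact: (measurableT_comp (@measurable_coord R r j)).
Qed.

Lemma measurable_evalxl (p : mpoly (n + r) R) :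
  measurable_fun setT
    (fun u : 'rV[R]_n * 'rV[R]_r => evalxl p u.1 u.2).
Proof.
under eq_fun do rewrite evalxl_sum.
apply: measurable_sum => a.
apply: measurable_funM => //; apply: measurable_prod => i _.
apply: measurable_funX.
exact: (measurableT_comp (@measurable_coord R (n + r) i) measurable_row_mx).
Qed.

Lemma continuous_evalxl (p : mpoly (n + r) R) x : continuous (evalxl p x).
Proof.
rewrite (_ : evalxl p x = fun l => \sum_(a <- msupp p) mcoeff a p *
    \prod_i (row_mx x l 0 i) ^+ (a : multinom (n + r)) i); last first.
  by apply/funext => l; rewrite evalxl_sum.
apply: continuous_sum => a l.
apply: continuousM; first exact: cst_continuous.
apply: continuous_prod => i {}l.
apply: (continuous_comp (g := fun t : R => t ^+ a i)); last exact: exprn_continuous.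
rewrite (_ : (fun l' : 'rV[R]_r => row_mx x l' 0 i) = fun l' : 'rV[R]_r =>
    match fintype.split i with inl j => x 0 j | inr j => l' 0 j end).
  by case: fintype.split => j; [exact: cst_continuous|exact: coord_continuous].
by apply/funext => l'; rewrite mxE.
Qed.

Lemma evalxl_inclx p x l : evalxl (inclx (r := r) p) x l = meval (x 0) p.
Proof.
rewrite /evalxl /inclx comp_mpoly_meval; apply: meval_eq => i.
by rewrite tnth_mktuple mevalXU row_mxEl.
Qed.

Lemma evalxl_lambda_var k x l : evalxl (lambda_var k) x l = l 0 k.
Proof. by rewrite /evalxl /lambda_var mevalXU row_mxEr. Qed.

Lemma sos_ge0 (s : mpoly n R) v : sos s -> 0 <= meval v s.
Proof.
move=> [qs ->]; rewrite rmorph_sum; apply: sumr_ge0 => q _.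
by rewrite rmorphXn sqr_ge0.
Qed.

Lemma qmodule_ge0 m (g : 'I_m -> mpoly (n + r) R) p x l :
  qmodule_x g p -> Kset g (x, l) -> 0 <= evalxl p x l.
Proof.
move=> [s0 [s [s0_sos s_sos ->]]] Kxl.
have incl_ge0 s' : sos s' -> 0 <= meval (row_mx x l 0) (inclx s').
  by move=> /sos_ge0; have := evalxl_inclx s' x l; rewrite /evalxl => ->.
rewrite /evalxl mevalD; apply: addr_ge0; first exact: incl_ge0.
rewrite raddf_sum /=.
apply: sumr_ge0 => i _; rewrite mevalM.
by apply: mulr_ge0; [exact: incl_ge0|exact: (Kxl i)].
Qed.

Lemma Kset_Vr_bounded m (g : 'I_m -> mpoly (n + r) R) p :
  restricted_archimedean g -> Vr p ->
  exists N, forall x l, Kset g (x, l) -> `|evalxl p x l| <= N.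
Proof.
move=> garch /garch[N [_ Np Nm]]; exists N => x l Kxl.
have := qmodule_ge0 Np Kxl; have := qmodule_ge0 Nm Kxl.
rewrite /evalxl !mevalD mevalN !mevalC => *.
by rewrite ler_norml; apply/andP; split; lra.
Qed.

Lemma Vr_inclx (p : mpoly n R) : Vr (inclx (r := r) p).
Proof.
exists p, (fun=> 0); rewrite big1 ?addr0// => k _.
by rewrite /inclx comp_mpoly0 mulr0.
Qed.

Lemma Vr_lambda_var (k : 'I_r) : Vr (lambda_var (R := R) (n := n) k).
Proof.
exists 0, (fun j => if j == k then 1 else 0).
rewrite /inclx comp_mpoly0 add0r (bigD1 k)//= eqxx comp_mpoly1 mulr1 big1 ?addr0//.
by move=> j /negbTE ->; rewrite comp_mpoly0 mulr0.
Qed.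

Lemma Kset_bounded m (g : 'I_m -> mpoly (n + r) R) :
  restricted_archimedean g -> exists N : R, forall x l, Kset g (x, l) ->
    (forall i, `|x 0 i| <= N) /\ (forall k, `|l 0 k| <= N).
Proof.
move=> garch.
have /choice[Nx NxP] i := Kset_Vr_bounded garch (Vr_inclx (mpolyX R (mnm1 i))).
have /choice[Nl NlP] k := Kset_Vr_bounded garch (Vr_lambda_var k).
(* With absolute values all summands are nonnegative, so the sum dominates each individual bound. *)
exists (\sum_i `|Nx i| + \sum_k `|Nl k|) => x l Kxl; split => i.
  apply: (@le_trans _ _ (Nx i)).
    by have := NxP i x l Kxl; rewrite evalxl_inclx mevalXU.
  apply: (le_trans (ler_norm _)); rewrite (bigD1 i)//= -addrA lerDl.
  by rewrite addr_ge0 ?sumr_ge0.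
apply: (@le_trans _ _ (Nl i)).
  by have := NlP i x l Kxl; rewrite evalxl_lambda_var.
apply: (le_trans (ler_norm _)); rewrite [X in _ + X](bigD1 i)//= addrCA lerDl.
by rewrite addr_ge0 ?sumr_ge0.
Qed.

Lemma measurable_Kset m (g : 'I_m -> mpoly (n + r) R) : measurable (Kset g).
Proof.
rewrite (_ : Kset g = \bigcap_(i in [set: 'I_m])
    (fun u : 'rV[R]_n * 'rV[R]_r => evalxl (g i) u.1 u.2) @^-1` `[0, +oo[).
  apply: fin_bigcap_measurable => // i _; rewrite -[X in measurable X]setTI.
  by apply: measurable_evalxl => //; exact: measurable_itv.
apply/seteqP; split => u Ku i.
  by move=> _; rewrite /= in_itv/= andbT; exact: Ku.
by have := Ku i Logic.I; rewrite /= in_itv/= andbT.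
Qed.

Lemma closed_Lambda m (g : 'I_m -> mpoly (n + r) R) x : closed (Lambda g x).
Proof.
rewrite (_ : Lambda g x = \bigcap_(i in [set: 'I_m])
    evalxl (g i) x @^-1` [set t | 0 <= t]).
  apply: closed_bigI => i _; apply: closed_comp; last exact: closed_ge.
  by move=> l _; exact: continuous_evalxl.
by apply/seteqP; split => l Ll i; [move=> _; exact: Ll|exact: (Ll i Logic.I)].
Qed.

Lemma measurable_monomx (a : multinom n) :
  measurable_fun setT (fun x => monomx x a).
Proof.
apply: measurable_prod => i _; apply: measurable_funX.
exact: measurable_coord.
Qed.

End polynomial_evaluation.

(** * Moment determinacy on a box *)

Section indicator_approximation.
Context {R : realType}.
Implicit Types s y : R.

(** A division-free form of y^m <= 1/(1 + m(1 - y)). It serves both to absorb a factor [j] into a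
    geometric sequence and to make powers tend to 0. *)
Lemma expr_bernoulli_le1 y m : 0 <= y <= 1 -> y ^+ m * (1 + m%:R * (1 - y)) <= 1.
Proof.
move=> /andP[y0 y1]; elim: m => [|m IHm]; first by rewrite expr0 mul1r mul0r addr0.
have ym : y ^+ m.+1 <= 1 by rewrite exprn_ile1.
apply: (@le_trans _ _ (y * (y ^+ m * (1 + m%:R * (1 - y))) + y ^+ m.+1 * (1 - y))).
  by rewrite exprS -natr1; lra.
apply: (@le_trans _ _ (y * 1 + 1 * (1 - y))); last by lra.
by rewrite lerD// ?ler_wpM2l// ler_wpM2r// subr_ge0.
Qed.

Lemma expr_bernoulli_ge y m : 0 <= y <= 1 -> 1 - m%:R * y <= (1 - y) ^+ m.
Proof.
move=> /andP[y0 y1]; elim: m => [|m IHm]; first by rewrite expr0 mul0r subr0.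
apply: (@le_trans _ _ ((1 - m%:R * y) * (1 - y))).
  rewrite -natr1; have : 0 <= m%:R * y * y by rewrite !mulr_ge0.
  by lra.
by rewrite exprSr ler_wpM2r// subr_ge0.
Qed.

(* The exponent [j 2^j] rather than [2^j] makes the limit at [s = 1/2] equal
   to 0 instead of 1/e. *)
Lemma cvg_indicator_lt_half s : 0 <= s <= 1 ->
  (fun j : nat => (1 - s ^+ j) ^+ (j * 2 ^ j)) @ \oo --> ((s < 2^-1)%R%:R : R).
Proof.
move=> /andP[s0 s1].
have sj j : 0 <= s ^+ j <= 1 by rewrite exprn_ge0// exprn_ile1.
have nat_sj j : (j * 2 ^ j)%:R * s ^+ j = j%:R * (2 * s) ^+ j.
  by rewrite natrM natrX exprMn mulrA.
case: (ltP s 2^-1) => s_half.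
  (* Here (2s)^j = y^j y^j: one factor absorbs [j], as j y^j <= 1/(1 - y), and the other keeps the
     bound geometric. *)
  pose y := Num.sqrt (2 * s).
  have y0 : 0 <= y by exact: sqrtr_ge0.
  have yE : y ^+ 2 = 2 * s by rewrite sqr_sqrtr// mulr_ge0.
  have y1 : y < 1.
    have : y ^+ 2 < 1 by rewrite yE; lra.
    by rewrite -[ltRHS](expr1n R 2) ltr_pXn2r ?nnegrE.
  have bnd j : j%:R * (2 * s) ^+ j <= (1 - y)^-1 * y ^+ j.
    rewrite -yE -exprM mulnC exprM expr2 mulrA ler_wpM2r ?exprn_ge0//.
    rewrite -[leRHS]mul1r ler_pdivlMr ?subr_gt0//.
    have := @expr_bernoulli_le1 y j; rewrite y0 (ltW y1) => /(_ isT).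
    have := exprn_ge0 j y0; lra.
  apply: (@squeeze_cvgr _ _ _ _ (fun j => 1 - geometric (1 - y)^-1 y j) (cst 1)).
  - near=> j; apply/andP; split.
      apply: le_trans (expr_bernoulli_ge (j * 2 ^ j) (sj j)).
      by rewrite nat_sj lerD2l lerN2; exact: bnd.
    by rewrite exprn_ile1// ?subr_ge0 ?lerBlDr ?lerDl; case/andP: (sj j).
  - rewrite -[X in _ --> X](subr0 1); apply: cvgB; first exact: cvg_cst.
    by apply: cvg_geometric; rewrite ger0_norm.
  - exact: cvg_cst.
(* For s >= 1/2 one has j 2^j s^j = j (2s)^j >= j, so the Bernoulli bound is at most 1/(1 + j). *)
apply: (@squeeze_cvgr _ _ _ _ (cst 0) (@harmonic R)).
- near=> j; have /andP[sj0 sj1] := sj j.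
  have sj' : 0 <= 1 - s ^+ j <= 1 by rewrite subr_ge0 sj1 lerBlDr lerDl.
  rewrite exprn_ge0 ?subr_ge0//= /harmonic -[leRHS]mul1r ler_pdivlMr//.
  apply: le_trans (expr_bernoulli_le1 (j * 2 ^ j) sj').
  rewrite ler_wpM2l ?exprn_ge0 ?subr_ge0// subKr nat_sj -natr1 addrC lerD2l.
  by rewrite ler_peMr// exprn_ege1//; lra.
- exact: cvg_cst.
- exact: cvg_harmonic.
Unshelve. all: by end_near. Qed.

End indicator_approximation.

Lemma cvg_prod (R : realType) I (s : seq I) (u : I -> nat -> R) (l : I -> R) :
  (forall i, u i @ \oo --> l i) ->
  (fun j => \prod_(i <- s) u i j) @ \oo --> \prod_(i <- s) l i.
Proof.
move=> ul; elim: s => [|i s IHs].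
  rewrite big_nil (_ : (fun j => _) = cst 1); first exact: cvg_cst.
  by apply/funext => j; rewrite big_nil.
rewrite big_cons (_ : (fun j => _) = fun j => u i j * \prod_(k <- s) u k j).
  exact: cvgM.
by apply/funext => j; rewrite big_cons.
Qed.

Section moment_functional.
Context (R : realType) (n : nat).

(** The map [X] allows moments on different spaces to be compared: it will be the projection [fst]
    on R^n x R^r and the identity on R^n. *)
Definition wmean d (T : measurableType d) (P : probability T R)
    (X : T -> 'rV[R]_n) (w : T -> R) (f : 'rV[R]_n -> R) : \bar R :=
  (\int[P]_t (f (X t) * w t)%:E)%E.

(* The weight vanishes where [X] leaves the box, so the integrands of [wmean] are
   bounded everywhere. *)
Definition boxed d (T : measurableType d) (N : R) (X : T -> 'rV[R]_n)
    (w : T -> R) : Prop :=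
  [/\ measurable_fun setT X, measurable_fun setT w,
      forall t, `|w t| <= N &
      forall t i, w t != 0 -> `|X t 0 i| <= N].

(** On the box, [|v_i - a_i| <= N + |a_i|], so the inner affine form takes values in [0, 1] and
    equals 1/2 at [a_i]; the added 1 keeps the denominator positive. *)
Definition box_poly (N : R) (a : 'I_n -> R) (j : nat) : mpoly n R :=
  \prod_i (1 - (mpolyC n (2^-1) + mpolyC n (2 * (N + `|a i| + 1))^-1 *
     (mpolyX R (mnm1 i) - mpolyC n (a i))) ^+ j) ^+ (j * 2 ^ j).

Let aff (N a v : R) : R := 2^-1 + (2 * (N + `|a| + 1))^-1 * (v - a).

Lemma meval_box_poly N a j v : meval v (box_poly N a j) =
  \prod_i (1 - aff N (a i) (v i) ^+ j) ^+ (j * 2 ^ j).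
Proof.
rewrite /box_poly rmorph_prod; apply: eq_bigr => i _.
rewrite rmorphXn/= mevalB meval1 rmorphXn/= mevalD mevalM mevalB mevalXU.
by rewrite !mevalC.
Qed.

Let aff_itv N a v : `|v| <= N -> 0 <= aff N a v <= 1.
Proof.
move=> vN; have N0 : 0 <= N := le_trans (normr_ge0 v) vN.
have M0 : 0 < 2 * (N + `|a| + 1) by rewrite mulr_gt0// ltr_wpDl// addr_ge0.
have : `|v - a| <= N + `|a| by rewrite (le_trans (ler_normB _ _))// lerD2r.
rewrite ler_norml => /andP[va1 va2].
have h1 : (2 * (N + `|a| + 1))^-1 * (v - a) <= 2^-1.
  by rewrite mulrC ler_pdivrMr//; lra.
have h2 : - 2^-1 <= (2 * (N + `|a| + 1))^-1 * (v - a).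
  by rewrite mulrC ler_pdivlMr//; lra.
by rewrite /aff; apply/andP; split; lra.
Qed.

Let aff_lt N a v : `|v| <= N -> (aff N a v < 2^-1) = (v < a).
Proof.
move=> vN; have N0 : 0 <= N := le_trans (normr_ge0 v) vN.
have M0 : 0 < 2 * (N + `|a| + 1) by rewrite mulr_gt0// ltr_wpDl// addr_ge0.
by rewrite /aff gtrDl pmulr_rlt0 ?invr_gt0// subr_lt0.
Qed.

Lemma box_poly_le1 N a j (v : 'rV[R]_n) : (forall i, `|v 0 i| <= N) ->
  `|meval (v 0) (box_poly N a j)| <= 1.
Proof.
move=> vN; rewrite meval_box_poly normr_prod.
apply: prodr_ile1 => i _; rewrite normr_ge0/= normrX exprn_ile1//.
have /andP[s0 s1] := aff_itv (a i) (vN i).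
by rewrite ger0_norm ?subr_ge0 ?exprn_ile1// lerBlDr lerDl exprn_ge0.
Qed.

Lemma cvg_box_poly N a (v : 'rV[R]_n) : (forall i, `|v 0 i| <= N) ->
  meval (v 0) (box_poly N a j) @[j --> \oo] --> (\1_(orthant a) v : R).
Proof.
move=> vN.
have -> : \1_(orthant a) v = \prod_i (v 0 i < a i)%R%:R :> R.
  rewrite indicE; case: (boolP (v \in orthant a)) => [/set_mem va|/negP va].
    by rewrite big1// => i _; rewrite va.
  have [i via] : exists i, ~~ (v 0 i < a i).
    apply: contrapT => /forallNP h; apply: va; rewrite inE => i.
    by apply: contrapT => /negP; exact: h.
  by rewrite (bigD1 i)//= (negbTE via) mul0r.
rewrite [X in X @ _ --> _](_ : _ = fun j =>
    \prod_i (1 - aff N (a i) (v 0 i) ^+ j) ^+ (j * 2 ^ j)); last first.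
  by apply/funext => j; rewrite meval_box_poly.
apply: cvg_prod => i; rewrite -(aff_lt (a i) (vN i)).
exact: cvg_indicator_lt_half (aff_itv _ (vN i)).
Qed.

Section one_functional.
Context d (T : measurableType d) (P : probability T R) (N : R)
  (X : T -> 'rV[R]_n) (w : T -> R).
Hypothesis XwN : boxed N X w.

Lemma integrable_boxed (f : 'rV[R]_n -> R) (C : R) : measurable_fun setT f ->
  (forall v : 'rV[R]_n, (forall i, `|v 0 i| <= N) -> `|f v| <= C) ->
  P.-integrable setT (fun t => (f (X t) * w t)%:E).
Proof.
move=> mf fC; have [mX mw wN XN] := XwN.
apply: (le_integrable measurableT (g := cst (`|C| * N)%:E)).
- by apply/measurable_EFinP; apply: measurable_funM => //; exact: measurableT_comp.
- move=> t _; rewrite !abse_EFin lee_fin [leRHS]ger0_norm; last first.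
    by rewrite mulr_ge0// (le_trans (normr_ge0 (w t))).
  have [->|/XN Xt] := eqVneq (w t) 0.
    by rewrite mulr0 normr0 mulr_ge0// (le_trans (normr_ge0 (w t))).
  by rewrite normrM ler_pM// (le_trans (fC _ Xt))// ler_norm.
- exact: finite_measure_integrable_cst.
Qed.

Lemma integrable_monomx_boxed a :
  P.-integrable setT (fun t => (monomx (X t) a * w t)%:E).
Proof.
apply: (@integrable_boxed (monomx ^~ a) (\prod_i N ^+ a i)).
  exact: measurable_monomx.
move=> v vN; rewrite normr_prod; apply: ler_prod => i _.
by rewrite normr_ge0 normrX lerXn2r ?nnegrE ?(le_trans _ (vN i)).
Qed.

Lemma wmean_meval (q : mpoly n R) : wmean P X w (fun v => meval (v 0) q) =
  (\sum_(a <- msupp q) (mcoeff a q)%:E * wmean P X w (monomx ^~ a))%E.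
Proof.
rewrite /wmean; under eq_integral.
  move=> t _; rewrite mevalE mulr_suml -sumEFin.
  under eq_bigr do rewrite -mulrA EFinM.
  over.
rewrite integral_sum//.
  by apply: eq_bigr => a _; rewrite integralZl//; exact: integrable_monomx_boxed.
by move=> a; apply: integrableZl => //; exact: integrable_monomx_boxed.
Qed.

(** Dominated convergence with bound [N]: in the box the polynomials are at most 1 in modulus and
    the weight at most [N]; outside it the weight is zero. *)
Lemma cvg_wmean_orthant a :
  wmean P X w (fun v => meval (v 0) (box_poly N a j)) @[j --> \oo] -->
  wmean P X w \1_(orthant a).
Proof.
have [mX mw wN XN] := XwN.
have mi : measurable_fun setT (\1_(orthant a) : 'rV[R]_n -> R).
  by apply: measurable_indic; exact: measurable_orthant.
have mq j : measurable_fun setT (fun v : 'rV[R]_n => meval (v 0) (box_poly N a j)).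
  under eq_fun do rewrite mevalE.
  apply: measurable_sum => b; apply: measurable_funM => //.
  exact: measurable_monomx.
have [|||||_ _] := @dominated_convergence _ _ _ P setT measurableT
  (fun j t => (meval (X t 0) (box_poly N a j) * w t)%:E)
  (fun t => (\1_(orthant a) (X t) * w t)%:E) (cst N%:E); last by [].
- move=> j; apply/measurable_EFinP; apply: measurable_funM => //.
  exact: (measurableT_comp (mq j)).
- by apply/measurable_EFinP; apply: measurable_funM => //; exact: measurableT_comp.
- apply: aeW => t _; apply: cvg_EFin; first exact: nearW.
  have [->|/XN Xt] := eqVneq (w t) 0.
    by rewrite mulr0; under eq_fun do rewrite mulr0; exact: cvg_cst.
  by apply: cvgM; [exact: cvg_box_poly|exact: cvg_cst].
- exact: finite_measure_integrable_cst.
- apply: aeW => t j _; rewrite abse_EFin lee_fin.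
  have [->|/XN Xt] := eqVneq (w t) 0.
    by rewrite mulr0 normr0 (le_trans (normr_ge0 (w t))).
  rewrite normrM -[leRHS]mul1r ler_pM//; exact: box_poly_le1.
Qed.

End one_functional.
End moment_functional.

Section moment_determinacy.
Context (R : realType) (n : nat).

Lemma wmean_indic d (T : measurableType d) (P : probability T R)
    (X : T -> 'rV[R]_n) (w : T -> R) A :
  wmean P X w \1_A = (\int[P]_(t in X @^-1` A) (w t)%:E)%E.
Proof.
rewrite /wmean [RHS]integral_mkcond; apply: eq_integral => t _.
rewrite patchE indicE; case: ifPn => [/set_mem XA|/negP XA].
  by rewrite mem_set// mul1r.
by rewrite memNset ?mul0r// => XA'; apply: XA; exact: mem_set.
Qed.

Context d1 d2 (T1 : measurableType d1) (T2 : measurableType d2)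
  (P1 : probability T1 R) (P2 : probability T2 R) (N : R)
  (X1 : T1 -> 'rV[R]_n) (X2 : T2 -> 'rV[R]_n) (w1 : T1 -> R) (w2 : T2 -> R).
Hypotheses (XwN1 : boxed N X1 w1) (XwN2 : boxed N X2 w2).
Hypothesis moments : forall a,
  wmean P1 X1 w1 (monomx ^~ a) = wmean P2 X2 w2 (monomx ^~ a).

Let wmean_orthant a : wmean P1 X1 w1 \1_(orthant a) = wmean P2 X2 w2 \1_(orthant a).
Proof.
have := cvg_wmean_orthant (P := P1) (a := a) XwN1.
have := cvg_wmean_orthant (P := P2) (a := a) XwN2.
rewrite (_ : (fun j => wmean P2 X2 w2 _) = fun j =>
    wmean P1 X1 w1 (fun v => meval (v 0) (box_poly N a j))).
  by move=> h2 h1; exact: cvg_unique h1 h2.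
apply/funext => j; rewrite !(@wmean_meval _ _ _ _ _ N)//.
by apply: eq_bigr => b _; rewrite moments.
Qed.

Let mpreimage d (T : measurableType d) (X : T -> 'rV[R]_n) w A :
  boxed N X w -> measurable A -> measurable (X @^-1` A).
Proof. by case=> mX _ _ _ mA; rewrite -[X in measurable X]setTI; exact: mX. Qed.

Let integrable_w d (T : measurableType d) (P : probability T R)
    (X : T -> 'rV[R]_n) w :
  boxed N X w -> P.-integrable setT (fun t => (w t)%:E).
Proof.
move=> bXw; have := integrable_boxed P bXw (f := cst 1) (C := 1).
under eq_fun do rewrite mul1r.
by apply=> [|v _]; rewrite ?normr1//; exact: measurable_cst.
Qed.

Let integral_preimageC d (T : measurableType d) (P : probability T R)
    (X : T -> 'rV[R]_n) w A :
  boxed N X w -> measurable A ->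
  (\int[P]_(t in X @^-1` (~` A)) (w t)%:E =
   \int[P]_t (w t)%:E - \int[P]_(t in X @^-1` A) (w t)%:E)%E.
Proof.
move=> bXw mA; have iw := integrable_w P bXw; have mXA := mpreimage bXw mA.
have mw := measurable_int _ iw.
rewrite [X in (X - _)%E](_ : _ = \int[P]_(t in X @^-1` (~` A)) (w t)%:E +
    \int[P]_(t in X @^-1` A) (w t)%:E)%E.
  by rewrite addeK// integrable_fin_num//; exact: integrableS iw.
rewrite -integral_setU//.
- by rewrite -preimage_setU setvU preimage_setT.
- by apply: mpreimage bXw _; exact: measurableC.
- exact: measurable_funTS.
- by apply/disj_setPS => t [].
Qed.

(** Equal moments give equal weighted means of the polynomials [box_poly], hence of orthant
    indicators in the limit; Dynkin's theorem extends this to Borel sets. *)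
Lemma moment_determinacy A : measurable A ->
  (\int[P1]_(t in X1 @^-1` A) (w1 t)%:E = \int[P2]_(t in X2 @^-1` A) (w2 t)%:E)%E.
Proof.
(* The moment of order 0 gives equal total weights, needed for complements. *)
have intT : (\int[P1]_t (w1 t)%:E = \int[P2]_t (w2 t)%:E)%E.
  have monomx0 v : monomx v (@mnm0 n) = 1 :> R.
    by rewrite /monomx big1// => i _; rewrite mnm0E expr0.
  have := moments (@mnm0 n); rewrite /wmean.
  under eq_integral do rewrite monomx0 mul1r.
  by under [RHS]eq_integral do rewrite monomx0 mul1r.
move=> mA; have : <<s range (@orthant R n) >> A by rewrite -measurable_rV_orthant.
apply: (dynkin_induction (P := fun A => (\int[P1]_(t in X1 @^-1` A) (w1 t)%:E =
  \int[P2]_(t in X2 @^-1` A) (w2 t)%:E)%E)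
  (@measurable_rV_orthant R n) (@orthant_setI R n)).
- exact: intT.
- by move=> _ [a _ <-]; rewrite -!wmean_indic; exact: wmean_orthant.
- by move=> S mS IH; rewrite !integral_preimageC// IH intT.
- move=> F mF tF IH.
  have tXF (T : Type) (X : T -> 'rV[R]_n) :
      trivIset setT (fun k => X @^-1` F k).
    apply/trivIsetP => i j _ _ ij.
    by move/trivIsetP : tF => /(_ i j Logic.I Logic.I ij);
      rewrite -preimage_setI => ->; rewrite preimage_set0.
  rewrite !preimage_bigcup !integral_bigcup//.
  + by apply: eq_eseriesr => i _; exact: IH.
  + by move=> k; exact: mpreimage XwN2 (mF k).
  + apply: integrableS (integrable_w P2 XwN2) => //.
    by apply: bigcup_measurable => k _; exact: mpreimage XwN2 (mF k).
  + by move=> k; exact: mpreimage XwN1 (mF k).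
  + apply: integrableS (integrable_w P1 XwN1) => //.
    by apply: bigcup_measurable => k _; exact: mpreimage XwN1 (mF k).
Qed.

End moment_determinacy.

(** * Representing measures *)

Lemma integrable_bounded d (T : measurableType d) (R : realType)
    (m : {measure set T -> \bar R}) (A : set T) (h : T -> R) (C : R) :
  measurable A -> (m A < +oo)%E -> measurable_fun A h ->
  (forall t, A t -> `|h t| <= C) -> m.-integrable A (EFin \o h).
Proof.
move=> mA Aoo mh hC; apply: measurable_bounded_integrable => //.
exists C; split; first exact: num_real.
by move=> M CM t At; exact: le_trans (hC t At) (ltW CM).
Qed.

Section bounded_disintegration.
Context d1 d2 (X : measurableType d1) (Y : measurableType d2) (R : realType)
  (k : R.-pker X ~> Y) (f : X * Y -> R) (C : R).
Hypotheses (mf : measurable_fun setT f) (fC : forall u, `|f u| <= C).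

(** Adding [C] makes the integrand nonnegative, so that the results for nonnegative functions apply;
    the constant is cancelled afterwards. *)
Let fC0 u : (0 <= (f u + C)%:E)%E.
Proof. by have := fC u; rewrite lee_fin ler_norml => /andP[]; lra. Qed.

Let mfC : measurable_fun setT (fun u => (f u + C)%:E).
Proof. by apply/measurable_EFinP; exact: measurable_funD. Qed.

Let integralDcst d (T : measurableType d) (m : {measure set T -> \bar R})
    (h : T -> R) : m setT = 1%E -> measurable_fun setT h ->
  (forall t, `|h t| <= C) ->
  (\int[m]_t (h t + C)%:E = \int[m]_t (h t)%:E + C%:E)%E.
Proof.
move=> m1 mh hC; under eq_integral do rewrite EFinD.
have moo : (m setT < +oo)%E by rewrite m1 ltry.
rewrite integralD//.
- by rewrite integral_cst// m1 mule1.
- by apply: (integrable_bounded (C := C)).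
- by apply: (integrable_bounded (h := cst C) (C := `|C|)).
Qed.

Let k1 x : k x setT = 1%E. Proof. exact: prob_kernel. Qed.

Let mfx x : measurable_fun setT (fun y => f (x, y)).
Proof. exact: measurableT_comp. Qed.

Let innerDcst x :
  (\int[k x]_y (f (x, y) + C)%:E = \int[k x]_y (f (x, y))%:E + C%:E)%E.
Proof. exact: (integralDcst (k1 x) (mfx x) (fun=> fC _)). Qed.

Let inner_bounded x : (`|\int[k x]_y (f (x, y))%:E| <= C%:E)%E.
Proof.
apply: (le_trans (le_abse_integral _ _ _)) => //; first exact/measurable_EFinP.
apply: (@le_trans _ _ (\int[k x]_y (cst C%:E y))%E).
  apply: ge0_le_integral => //.
  - by apply: measurableT_comp => //; exact/measurable_EFinP.
  - by move=> y _; rewrite abse_EFin lee_fin.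
by rewrite integral_cst// k1 mule1.
Qed.

Let inner_fin x : (\int[k x]_y (f (x, y))%:E)%E \is a fin_num.
Proof.
by apply: integrable_fin_num => //; apply: (integrable_bounded (C := C));
  rewrite ?k1 ?ltry.
Qed.

Lemma measurable_integral_pker_bounded :
  measurable_fun setT (fun x => \int[k x]_y (f (x, y))%:E)%E.
Proof.
have := measurable_fun_integral_finite_kernel _ k fC0 mfC.
rewrite (_ : (fun x => _) = fun x => \int[k x]_y (f (x, y))%:E + C%:E)%E.
  move=> mh; have := emeasurable_funB mh (measurable_cst C%:E).
  by apply: eq_measurable_fun => x _; rewrite /= addeK.
by apply/funext => x; rewrite innerDcst.
Qed.

Lemma integral_disintegration_bounded (mu : probability X R)
    (rho : probability (X * Y)%type R) :
  (forall A, measurable A -> rho A = \int[mu]_x k x (xsection A x))%E ->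
  (\int[rho]_u (f u)%:E = \int[mu]_x \int[k x]_y (f (x, y))%:E)%E.
Proof.
move=> rhoE.
have := ge0_integral_disintegration rhoE mfC fC0.
rewrite integralDcst; [|exact: (@probability_setT _ _ _ rho)|by []|by []].
(* The inner integrals are finite; read as a real function bounded by [C], they allow the constant
   to be taken out of the outer integral too. *)
under [RHS]eq_integral do rewrite innerDcst -(fineK (inner_fin _)) -EFinD.
have mb : measurable_fun setT (fun x => fine (\int[k x]_y (f (x, y))%:E)%E).
  by apply: measurableT_comp => //; exact: measurable_integral_pker_bounded.
have bC x : `|fine (\int[k x]_y (f (x, y))%:E)%E| <= C.
  have := inner_bounded x.
  by rewrite -[X in (`|X|)%E](fineK (inner_fin x)) abse_EFin lee_fin.
rewrite (integralDcst (@probability_setT _ _ _ mu) mb bC).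
under [in X in _ = X -> _]eq_integral do rewrite fineK//.
by move=> /(congr1 (fun z => z - C%:E)%E); rewrite !addeK.
Qed.

End bounded_disintegration.

Section representing_measures.
Context (R : realType) (n r m : nat) (g : 'I_m -> mpoly (n + r) R).
Implicit Types (rho : probability ('rV[R]_n * 'rV[R]_r)%type R)
  (mu : probability 'rV[R]_n R) (k : R.-pker 'rV[R]_n ~> 'rV[R]_r).

Lemma xsection_Kset x : xsection (Kset g) x = Lambda g x.
Proof. by rewrite xsectionE. Qed.

Lemma measurable_Lambda x : measurable (Lambda g x).
Proof.
by rewrite -xsection_Kset; apply: measurable_xsection; exact: measurable_Kset.
Qed.

Lemma disintegration_ae_Lambda rho mu k :
  rho (Kset g) = 1%E -> disintegration rho mu k ->
  {ae mu, forall x, k x (~` Lambda g x) = 0%E}.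
Proof.
move=> rhoK rhoE; have mK := measurable_Kset g.
have mh : measurable_fun setT (fun x => k x (xsection (~` Kset g) x)).
  by apply: measurable_pker_xsection; exact: measurableC.
have : (\int[mu]_x `|k x (xsection (~` Kset g) x)| = 0)%E.
  under eq_integral do rewrite gee0_abs//.
  rewrite -rhoE; last exact: measurableC.
  by rewrite probability_setC// rhoK subee.
move=> /(ae_eq_integral_abs mu measurableT mh); apply: filterS => x /= /(_ Logic.I).
by rewrite xsectionE => <-.
Qed.

(** A point outside the closed set [Lambda g x] has its complement as an open neighbourhood of mass
    zero. *)
Lemma msupport_Lambda k x : k x (~` Lambda g x) = 0%E ->
  msupport (k x) `<=` Lambda g x.
Proof.
move=> k0 l suppl; apply: contrapT => nl.
have := suppl _ (closed_openC (@closed_Lambda _ _ _ _ g x)) nl.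
by rewrite k0 ltxx.
Qed.

Lemma pker_Lambda k x : k x (~` Lambda g x) = 0%E -> k x (Lambda g x) = 1%E.
Proof.
move=> k0; rewrite -(@prob_kernel _ _ _ _ _ k x) -(setvU (Lambda g x)).
rewrite measureU//; last by rewrite setICl.
- by rewrite [X in _ = (X + _)%E]k0 add0e.
- by apply: measurableC; exact: measurable_Lambda.
- exact: measurable_Lambda.
Qed.

Section integral_Lambda.
Variables (phi : 'rV[R]_r -> R) (D : R).
Hypothesis mphi : measurable_fun setT phi.
Hypothesis phiD : forall x l, Kset g (x, l) -> `|phi l| <= D.

(** Cutting off outside K gives a function bounded everywhere. The bound is [|D|] because [D] may be
    negative when K is empty. *)
Let G (u : 'rV[R]_n * 'rV[R]_r) := \1_(Kset g) u * phi u.2.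

Let mG : measurable_fun setT G.
Proof.
apply: measurable_funM; last exact: measurableT_comp.
by apply: measurable_indic; exact: measurable_Kset.
Qed.

Let GD u : `|G u| <= `|D|.
Proof.
rewrite /G indicE; case: (boolP (u \in Kset g)) => [/set_mem|_].
  by case: u => x l Ku; rewrite mul1r (le_trans (phiD Ku))// ler_norm.
by rewrite mul0r normr0.
Qed.

Let integral_G k x :
  (\int[k x]_l (G (x, l))%:E = \int[k x]_(l in Lambda g x) (phi l)%:E)%E.
Proof.
have inK l : (x, l) \in Kset g = (l \in Lambda g x).
  by apply/idP/idP => /set_mem ?; exact/mem_set.
rewrite [RHS]integral_mkcond; apply: eq_integral => l _.
by rewrite patchE /G indicE inK; case: ifP => _; rewrite ?mul1r ?mul0r.
Qed.

Lemma measurable_integral_Lambda k :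
  measurable_fun setT (fun x => \int[k x]_(l in Lambda g x) (phi l)%:E)%E.
Proof.
have := measurable_integral_pker_bounded k mG GD.
by apply: eq_measurable_fun => x _.
Qed.

Lemma integral_Kset_disintegration rho mu k (h : 'rV[R]_n -> R) (C : R) :
  disintegration rho mu k -> measurable_fun setT h ->
  (forall x l, Kset g (x, l) -> `|h x| <= C) ->
  (\int[rho]_(u in Kset g) (h u.1 * phi u.2)%:E =
   \int[mu]_x ((h x)%:E * \int[k x]_(l in Lambda g x) (phi l)%:E))%E.
Proof.
move=> rhoE mh hC.
(* The indicator of K occurs twice, once here and once in [G], so that both factors are bounded
   separately. *)
pose F (u : 'rV[R]_n * 'rV[R]_r) := \1_(Kset g) u * h u.1 * G u.
have mF : measurable_fun setT F.
  apply: measurable_funM => //; apply: measurable_funM.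
    by apply: measurable_indic; exact: measurable_Kset.
  by apply: measurableT_comp => //; exact: measurable_fst.
have FC u : `|F u| <= `|C| * `|D|.
  rewrite /F normrM ler_pM//.
  rewrite indicE; case: (boolP (u \in Kset g)) => [/set_mem|_].
    by case: u => x l Ku; rewrite mul1r (le_trans (hC _ _ Ku))// ler_norm.
  by rewrite mul0r normr0.
transitivity (\int[rho]_u (F u)%:E)%E.
  rewrite [LHS]integral_mkcond; apply: eq_integral => u _.
  by rewrite patchE /F /G indicE; case: ifP => _; rewrite ?mul1r ?mul0r.
rewrite (integral_disintegration_bounded mF FC rhoE).
apply: eq_integral => x _; rewrite -integral_G -integralZl//.
  apply: eq_integral => l _; rewrite -EFinM /F /G indicE.
  by case: (_ \in _); rewrite ?mul1r ?mul0r ?mulr0.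
apply: (integrable_bounded (C := `|D|)) => //.
- by rewrite prob_kernel ltry.
- exact: (measurableT_comp mG).
Qed.

End integral_Lambda.

End representing_measures.

Lemma integral_ae_full d (T : measurableType d) (R : realType)
    (P : probability T R) (D A : set T) (f : T -> R) :
  measurable D -> measurable A -> measurable_fun setT f -> {ae P, forall t, D t} ->
  (\int[P]_(t in A) (\1_D t * f t)%:E = \int[P]_(t in A) (f t)%:E)%E.
Proof.
move=> mD mA mf Dae; apply: ae_eq_integral => //.
- apply/measurable_EFinP; apply: measurable_funTS; apply: measurable_funM => //.
- by apply/measurable_EFinP; exact: measurable_funTS.
- by apply: filterS Dae => t Dt _; rewrite indicE mem_set// mul1r.
Qed.

Lemma ae_probability1 d (T : measurableType d) (R : realType)
    (P : probability T R) (D : set T) :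
  measurable D -> P D = 1%E -> {ae P, forall t, D t}.
Proof.
move=> mD PD; exists (~` D); split => //; first exact: measurableC.
by rewrite probability_setC// PD subee.
Qed.

(** * Measures on K compared with the graph data *)

Section graph_data.
Context (R : realType) (n r m : nat) (g : 'I_m -> mpoly (n + r) R).
Hypothesis garch : restricted_archimedean g.
Variables (y : multinom n -> R) (z : 'I_r -> multinom n -> R)
  (mu : probability 'rV[R]_n R) (tau : 'rV[R]_n -> 'rV[R]_r).
Hypothesis mutau : graph_data g y z mu tau.
Implicit Types (rho : probability ('rV[R]_n * 'rV[R]_r)%type R)
  (k : R.-pker 'rV[R]_n ~> 'rV[R]_r).

(** Taking [N >= 1] makes the constant weight 1 admissible for the same bound. *)
Let bound_ex : exists N : R, 1 <= N /\ forall x l, Kset g (x, l) ->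
  (forall i, `|x 0 i| <= N) /\ (forall j, `|l 0 j| <= N).
Proof.
have [N NP] := Kset_bounded garch.
exists (`|N| + 1); split; first by rewrite lerDr.
move=> x l /NP[xN lN]; have NN : N <= `|N| + 1 by rewrite ler_wpDr// ler_norm.
by split => i; [exact: le_trans (xN i) NN|exact: le_trans (lN i) NN].
Qed.

Let N := sval (cid bound_ex).

Let N1 : 1 <= N. Proof. by case: (svalP (cid bound_ex)). Qed.

Let NP x l : Kset g (x, l) ->
  (forall i, `|x 0 i| <= N) /\ (forall j, `|l 0 j| <= N).
Proof. by case: (svalP (cid bound_ex)) => _; exact. Qed.

Let mtauj j : measurable_fun setT (fun x => tau x 0 j).
Proof. by case: mutau => _ /(_ j) /sub_Lfun_mfun + _ _ _; rewrite inE. Qed.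

Let mtau : measurable_fun setT tau. Proof. exact: measurable_rV. Qed.

(** A set of full [mu]-measure inside the box on which [tau] is bounded; multiplying by its
    indicator turns weights on the [mu] side into boxed ones. *)
Let D := [set x | Kset g (x, tau x)].

Let mD : measurable D.
Proof.
have : measurable_fun setT (fun x => (x, tau x)) by exact: measurable_fun_pair.
by move=> /(_ measurableT _ (measurable_Kset g)); rewrite setTI.
Qed.

Let Dae : {ae mu, forall x, D x}. Proof. by case: mutau. Qed.

Let mK := measurable_Kset g.

Let boxed_rho (phi : 'rV[R]_r -> R) : measurable_fun setT phi ->
  (forall x l, Kset g (x, l) -> `|phi l| <= N) ->
  boxed N (@fst 'rV[R]_n 'rV[R]_r) (fun u => \1_(Kset g) u * phi u.2).
Proof.
move=> mphi phiN; split => //.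
- apply: measurable_funM; [exact: measurable_indic|exact: measurableT_comp].
- move=> [x l]; rewrite indicE; case: (boolP (_ \in _)) => [/set_mem/phiN|_].
    by rewrite mul1r.
  by rewrite mul0r normr0 (le_trans ler01).
- move=> [x l] i; rewrite indicE; case: (boolP (_ \in _)) => [/set_mem/NP[xN _] _|_].
    exact: xN.
  by rewrite mul0r eqxx.
Qed.

Let boxed_mu (t : 'rV[R]_n -> R) : measurable_fun setT t ->
  (forall x, D x -> `|t x| <= N) -> boxed N id (fun x => \1_D x * t x).
Proof.
move=> mt tN; split => //.
- by apply: measurable_funM => //; exact: measurable_indic.
- move=> x; rewrite indicE; case: (boolP (_ \in _)) => [/set_mem/tN|_].
    by rewrite mul1r.
  by rewrite mul0r normr0 (le_trans ler01).
- move=> x i; rewrite indicE; case: (boolP (_ \in _)) => [/set_mem/NP[xN _] _|_].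
    exact: xN.
  by rewrite mul0r eqxx.
Qed.

(* [phi, t] is either [1, 1] or [l_j, tau_j]. *)
Let represents_integral rho (phi : 'rV[R]_r -> R) (t : 'rV[R]_n -> R) :
  rho (Kset g) = 1%E -> measurable_fun setT phi -> measurable_fun setT t ->
  (forall x l, Kset g (x, l) -> `|phi l| <= N) ->
  (forall x, D x -> `|t x| <= N) ->
  (forall a, \int[rho]_(u in Kset g) (monomx u.1 a * phi u.2)%:E =
             \int[mu]_x (monomx x a * t x)%:E)%E ->
  forall A, measurable A ->
    (\int[rho]_(u in fst @^-1` A) (phi u.2)%:E = \int[mu]_(x in A) (t x)%:E)%E.
Proof.
move=> rhoK mphi mt phiN tN moments A mA.
have mphi2 : measurable_fun setT (fun u : 'rV[R]_n * 'rV[R]_r => phi u.2).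
  exact: measurableT_comp.
have mfA : measurable (fst @^-1` A : set ('rV[R]_n * 'rV[R]_r)).
  by rewrite -[X in measurable X]setTI; exact: measurable_fst.
rewrite -(integral_ae_full mK mfA mphi2 (ae_probability1 mK rhoK)).
rewrite -(integral_ae_full mD mA mt Dae).
apply: (moment_determinacy (boxed_rho mphi phiN) (boxed_mu mt tN)) => // a.
transitivity (\int[mu]_x (monomx x a * t x)%:E)%E.
  rewrite -moments /wmean [RHS]integral_mkcond; apply: eq_integral => u _.
  rewrite patchE indicE; case: ifP => _; first by rewrite mul1r.
  by rewrite mul0r mulr0.
rewrite /wmean; under [RHS]eq_integral do rewrite mulrCA.
rewrite integral_ae_full//; apply: measurable_funM => //.
exact: measurable_monomx.
Qed.

Let lN j x l : Kset g (x, l) -> `|l 0 j| <= N.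
Proof. by move=> /NP[]. Qed.

Let tauN j x : D x -> `|tau x 0 j| <= N.
Proof. exact: lN. Qed.

Lemma represents_marginal rho : rho (Kset g) = 1%E -> represents g rho y z ->
  forall A, measurable A -> rho (fst @^-1` A) = mu A.
Proof.
move=> rhoK [repy _] A mA; case: mutau => _ _ yE _ _.
have mfA : measurable (fst @^-1` A : set ('rV[R]_n * 'rV[R]_r)).
  by rewrite -[X in measurable X]setTI; exact: measurable_fst.
have := @represents_integral rho (cst 1) (cst 1) rhoK (measurable_cst _)
  (measurable_cst _) _ _ _ _ mA.
rewrite /= !integral_cst// !mul1e; apply => [? ? _|? _|a].
- by rewrite normr1.
- by rewrite normr1.
by under eq_integral do rewrite mulr1; under [RHS]eq_integral do rewrite mulr1;
  rewrite repy yE.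
Qed.

(** For each Borel set [E], the integral of [tau_j] over [E] equals that of [lambda_j] over
    [E x R^r], which by disintegration is the integral over [E] of the conditional means. Functions
    with equal integrals over all [E] agree almost everywhere. *)
Lemma represents_barycenter rho k :
  rho (Kset g) = 1%E -> represents g rho y z -> disintegration rho mu k ->
  {ae mu, forall x, has_barycenter g x (k x) (tau x)}.
Proof.
move=> rhoK [_ repz] rhoE; case: mutau => _ _ _ zE _.
suff bary j : {ae mu, forall x,
    (\int[k x]_(l in Lambda g x) (l 0 j)%:E = (tau x 0 j)%:E)%E}.
  exact: filter_forall.
have moments a : (\int[rho]_(u in Kset g) (monomx u.1 a * u.2 0 j)%:E =
    \int[mu]_x (monomx x a * tau x 0 j)%:E)%E by rewrite zE repz.
have rhoA := represents_integral rhoK (measurable_coord j) (mtauj j) (@lN j)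
  (@tauN j) moments.
have mb := measurable_integral_Lambda (measurable_coord j) (@lN j) k.
(* The cut-off [tau_j] is bounded everywhere, hence integrable, and equals [tau_j] almost
   everywhere. *)
have mDtau : measurable_fun setT (fun x => \1_D x * tau x 0 j).
  by apply: measurable_funM => //; exact: measurable_indic.
have : ae_eq mu setT (fun x => (\1_D x * tau x 0 j)%:E)
    (fun x => \int[k x]_(l in Lambda g x) (l 0 j)%:E)%E.
  apply: integral_ae_eq => //.
    apply: (integrable_bounded (C := N)) => //.
    - by apply: (@le_lt_trans _ _ 1%E); [exact: probability_le1|exact: ltry].
    - by move=> x _; case: (boxed_mu (mtauj j) (@tauN j)).
  move=> E _ mE; rewrite integral_ae_full// -rhoA//.
  have mfE : measurable (fst @^-1` E : set ('rV[R]_n * 'rV[R]_r)).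
    by rewrite -[X in measurable X]setTI; exact: measurable_fst.
  rewrite -(integral_ae_full mK mfE _ (ae_probability1 mK rhoK)); last first.
    exact: (measurableT_comp (@measurable_coord R r j)).
  have E1 x (l : 'rV[R]_r) : Kset g (x, l) -> `|\1_E x : R| <= 1.
    by move=> _; rewrite indicE; case: (_ \in _); rewrite ?normr1 ?normr0.
  have intE := integral_Kset_disintegration (measurable_coord j) (@lN j) rhoE
    (measurable_indic mE) E1.
  transitivity (\int[rho]_(u in Kset g) (\1_E u.1 * u.2 0 j)%:E)%E.
    rewrite [LHS]integral_mkcond [RHS]integral_mkcond; apply: eq_integral => u _.
    rewrite !patchE !indicE (_ : (u \in fst @^-1` E) = (u.1 \in E))//.
    by do 2 case: ifP => _; rewrite ?mul1r ?mul0r.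
  rewrite intE [RHS]integral_mkcond; apply: eq_integral => x _.
  by rewrite patchE indicE; case: ifP => _; rewrite ?mul1e ?mul0e.
by apply: filterS2 Dae => x Dx /(_ Logic.I) <-; rewrite indicE mem_set// mul1r.
Qed.

Let disintegration_integral rho k (phi : 'rV[R]_r -> R) (t : 'rV[R]_n -> R) a :
  disintegration rho mu k -> measurable_fun setT phi -> measurable_fun setT t ->
  (forall x l, Kset g (x, l) -> `|phi l| <= N) ->
  {ae mu, forall x, (\int[k x]_(l in Lambda g x) (phi l)%:E = (t x)%:E)%E} ->
  (\int[rho]_(u in Kset g) (monomx u.1 a * phi u.2)%:E =
   \int[mu]_x (monomx x a * t x)%:E)%E.
Proof.
move=> rhoE mphi mt phiN bary; have mmon := @measurable_monomx R n a.
have monN x l : Kset g (x, l) -> `|monomx x a| <= \prod_i N ^+ a i.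
  move=> /NP[xN _]; rewrite normr_prod; apply: ler_prod => i _.
  by rewrite normr_ge0 normrX lerXn2r ?nnegrE ?(le_trans _ (xN i)).
rewrite (integral_Kset_disintegration mphi phiN rhoE mmon monN).
have mb := measurable_integral_Lambda mphi phiN k.
apply: ae_eq_integral => //.
- by apply: emeasurable_funM => //; exact/measurable_EFinP.
- by apply/measurable_EFinP; exact: measurable_funM.
- by apply: filterS bary => x -> _; rewrite EFinM.
Qed.

Lemma disintegration_represents rho k :
  rho (Kset g) = 1%E -> disintegration rho mu k ->
  {ae mu, forall x, has_barycenter g x (k x) (tau x)} ->
  represents g rho y z.
Proof.
move=> rhoK rhoE bary; case: mutau => _ _ yE zE _; split => [a|j a].
  rewrite -yE; transitivity (\int[rho]_(u in Kset g) (monomx u.1 a * 1)%:E)%E.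
    by apply: eq_integral => u _; rewrite mulr1.
  rewrite (@disintegration_integral rho k (cst 1) (cst 1))//.
  - by apply: eq_integral => x _; rewrite mulr1.
  - by move=> ? ? _; rewrite normr1.
  (* For weight 1 the condition on the inner integral says that [Lambda g x] has mass 1, which
     follows from [rho (Kset g) = 1]. *)
  - apply: filterS (disintegration_ae_Lambda rhoK rhoE) => x /pker_Lambda kL.
    rewrite /= integral_cst; last exact: measurable_Lambda.
    by rewrite kL mule1.
rewrite -zE; apply: (@disintegration_integral rho k (fun l => l 0 j)
  (fun x => tau x 0 j) a) => //.
- exact: measurable_coord.
- exact: lN.
- by apply: filterS bary => x; exact.
Qed.

End graph_data.

Theorem proposition4p2 (R : realType) (n r m : nat)
  (g : 'I_m -> mpoly (n + r) R)
  (gV : forall i, Vr (g i))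
  (garch : restricted_archimedean g)
  (y : multinom n -> R) (z : 'I_r -> multinom n -> R)
  (yz : exists rho : probability ('rV[R]_n * 'rV[R]_r)%type R,
          rho (Kset g) = 1%E /\ represents g rho y z)
  (mu : probability 'rV[R]_n R) (tau : 'rV[R]_n -> 'rV[R]_r)
  (mutau : graph_data g y z mu tau) :
  (forall rho : probability ('rV[R]_n * 'rV[R]_r)%type R,
     rho (Kset g) = 1%E ->
     (represents g rho y z <->
      exists pi : R.-pker 'rV[R]_n ~> 'rV[R]_r,
        disintegration rho mu pi /\
        {ae mu, forall x, msupport (pi x) `<=` Lambda g x /\
                          has_barycenter g x (pi x) (tau x)})) /\
  (forall rho : probability ('rV[R]_n * 'rV[R]_r)%type R,
     rho (Kset g) = 1%E -> represents g rho y z ->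
     (forall A : set 'rV[R]_n, measurable A -> rho (fst @^-1` A) = mu A) /\
     (forall pi : R.-pker 'rV[R]_n ~> 'rV[R]_r, disintegration rho mu pi ->
        {ae mu, forall x, has_barycenter g x (pi x) (tau x)})).
Proof.
split=> [rho rhoK|rho rhoK rep]; last first.
  split; first exact: (represents_marginal garch mutau rhoK rep).
  by move=> k; exact: (represents_barycenter garch mutau rhoK rep).
split=> [rep|[k [rhoE kP]]]; last first.
  apply: (disintegration_represents garch mutau rhoK rhoE).
  by apply: filterS kP => x [].
have [k rhoE] := disintegrable_rV (represents_marginal garch mutau rhoK rep).
exists k; split => //.
apply: filterS2 (represents_barycenter garch mutau rhoK rep rhoE)
  (disintegration_ae_Lambda rhoK rhoE) => x bary k0; split => //.
exact: msupport_Lambda.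
Qed.
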